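(* Let $z:[0,\infty)\to[0,\infty]$ be nonincreasing and lower semi-continuous, set $c(\phi)=z(\phi)\phi$ (with $c(0)=0$), and let $\tau=\tau^z$, where $\tau^z(w)=\inf\{F^c[\psi]\mid\psi:\mathbb{R}\to[0,\infty),\ \int_{\mathbb{R}}\psi\,dy=w\}$. Let $g=(z^{-1}(\cdot))^{3/2}$ and $r(s)=\frac{2\sqrt2}{3\sqrt{-s}}$ for $s<0$, $r(s)=0$ otherwise. Then $$[-\tau(-\cdot)]^\ast(t)=[g*r](t)$$ holds for all $t\in\{\tau'(w)\mid w\geq0,\ \tau\text{ is differentiable at }w\}$.
   Context: For $c:[0,\infty)\to[0,\infty)$ and $\psi:\mathbb{R}\to\mathbb{R}$ (with locally integrable weak derivative; otherwise the energy is $+\infty$), $F^c[\psi]=\int_{\mathbb{R}}\frac12|\psi'(y)|^2+c(|\psi(y)|)\,dy$. The generalized inverse of a nonincreasing lower semi-continuous $f:[0,\infty)\to[0,\infty]$ is $f^{-1}(x)=\inf\{y\in[0,\infty)\mid f(y)\leq x\}$ with $\inf\emptyset=\infty$. $[-\tau(-\cdot)]^\ast$ is the Legendre–Fenchel conjugate of $s\mapsto-\tau(-s)$, where $\tau$ is extended by $-\infty$ on $(-\infty,0)$; explicitly $[-\tau(-\cdot)]^\ast(t)=\sup_{w\geq0}(\tau(w)-tw)$. Convolution: $[g*r](t)=\int_{\mathbb{R}}g(s)r(t-s)\,ds=\int_t^\infty\frac{2\sqrt2\,g(s)}{3\sqrt{s-t}}\,ds$. At $w=0$, $\tau'(0)$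 denotes the right derivative. *)

(* Defs.v *)
From HB Require Import structures.
From mathcomp Require Import all_boot all_order all_algebra.
From mathcomp Require Import all_classical all_reals all_analysis.
Set Implicit Arguments. Unset Strict Implicit. Unset Printing Implicit Defensive.
Import Order.TTheory GRing.Theory Num.Theory.
Import numFieldNormedType.Exports.
Local Open Scope classical_set_scope.
Local Open Scope ring_scope.

Section Defs.
Variable R : realType.
Local Notation mu := (@lebesgue_measure R).

Definition test_fun (phi : R -> R) : Prop :=
  (forall (n : nat) (x : R), derivable (derive1n n phi) x 1) /\
  (exists M : R, forall x : R, M < `|x| -> phi x = 0).

Definition weak_deriv (psi dpsi : R -> R) : Prop :=
  locally_integrable setT psi /\ locally_integrable setT dpsi /\
  forall phi : R -> R, test_fun phi ->
    (\int[mu]_(y in setT) (psi y * derive1 phi y)%:E =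
     - \int[mu]_(y in setT) (dpsi y * phi y)%:E)%E.

Definition c_of (z : R -> \bar R) (p : R) : \bar R :=
  if p == 0 then 0%E else (z p * p%:E)%E.

(* F^c[psi] = int 1/2 |psi'|^2 + c(|psi|), := +oo if no loc. integrable weak derivative *)
Definition energy (c : R -> \bar R) (psi : R -> R) : \bar R :=
  ereal_inf [set (\int[mu]_(y in setT) ((2^-1 * dpsi y ^+ 2)%:E + c (`|psi y|)%R))%E
            | dpsi in [set dpsi | weak_deriv psi dpsi]].

Definition tau_z (z : R -> \bar R) (w : R) : \bar R :=
  ereal_inf [set energy (c_of z) psi | psi in
     [set psi : R -> R | (forall y, 0 <= psi y) /\
                         (\int[mu]_(y in setT) (psi y)%:E = w%:E)%E]].

(* generalized inverse f^{-1}(x) = inf { y >= 0 | f y <= x }, inf of empty = +oo *)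
Definition gen_inv (f : R -> \bar R) (x : R) : \bar R :=
  ereal_inf [set y%:E | y in [set y : R | 0 <= y /\ (f y <= x%:E)%E]].

Definition g_of (z : R -> \bar R) (s : R) : \bar R := poweR (gen_inv z s) (3 / 2).

Definition r_ker (s : R) : R :=
  if s < 0 then 2 * Num.sqrt 2 / (3 * Num.sqrt (- s)) else 0.

Definition convol (g : R -> \bar R) (r : R -> R) (t : R) : \bar R :=
  (\int[mu]_(s in setT) (g s * (r (t - s))%:E))%E.

(* [-tau(-.)]^*(t) = sup_{w >= 0} (tau(w) - t w) *)
Definition conj_tau (tau : R -> \bar R) (t : R) : \bar R :=
  ereal_sup [set (tau w - (t * w)%:E)%E | w in [set w : R | 0 <= w]].

(* tau (a function on [0,oo)) is differentiable at w >= 0 with derivative d;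
   at w = 0 this is the right derivative (only h with w + h >= 0 are used). *)
Definition deriv_at (tau : R -> \bar R) (w d : R) : Prop :=
  0 <= w /\
  (exists e : R, 0 < e /\ forall h : R, `|h| < e -> 0 <= w + h -> tau (w + h) \is a fin_num) /\
  (forall eps : R, 0 < eps -> exists delta : R, 0 < delta /\
     forall h : R, 0 < `|h| < delta -> 0 <= w + h ->
       `|(fine (tau (w + h)) - fine (tau w)) / h - d| < eps).

Definition nonincreasing0 (z : R -> \bar R) : Prop :=
  forall x y : R, 0 <= x -> x <= y -> (z y <= z x)%E.

Definition lsc0 (z : R -> \bar R) : Prop :=
  forall (x : R) (a : \bar R), 0 <= x -> (a < z x)%E ->
    exists e : R, 0 < e /\ forall y : R, 0 <= y -> `|y - x| < e -> (a < z y)%E.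

End Defs.

(* Main.v *)
(* Let [G t] be the convolution.  Both inequalities come from the affine functions
   [w |-> G s + s * w].

   Every one of them lies above [tau]: a competitor is obtained by climbing linearly between
   the heights [h * l ^ (2 i)], [l] slightly above [1], with the slope for which the kinetic
   energy balances [(z - s)] times the height, then waiting on a plateau where [z] is close to
   [s] until half of the mass is used up, and reflecting.  The climb costs [G s] in the limit.

   Conversely a function [f] of mass [w] has energy at least [G s + s * w] with
   [s = inf (z \o f)]: by Young's inequality the excess [D ^ 2 / 2 + (z f - s) * f] dominates
   [sqrt f * |D|] times the kernel mass of [[s, z f]], and integrating over the layers
   [{z f > s'}] each of them contributes at least [g s'], because [f] climbs to the height
   [z^-1 s'] and down again.

   Where [tau] is differentiable with slope [t], the multipliers [s] of near-minimisers at
   nearby masses must therefore be close to [t], and [G] is lower semi-continuous. *)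

Require Import Defs.
From HB Require Import structures.
From mathcomp Require Import all_boot all_order all_algebra.
From mathcomp Require Import all_classical all_reals all_analysis.
From mathcomp Require Import measurable_realfun.
From mathcomp Require Import ring lra.
Set Implicit Arguments.
Unset Strict Implicit.
Unset Printing Implicit Defensive.
Import Order.TTheory GRing.Theory Num.Theory.
Import numFieldNormedType.Exports.
Local Open Scope classical_set_scope.
Local Open Scope ring_scope.

Section MonotoneIntegral.
Context d (T : measurableType d) (R : realType) (mu : {measure set T -> \bar R}).
Local Open Scope ereal_scope.

(* The integral of a nonnegative function is a supremum over simple functions, so
   neither the functions nor the sets need be measurable. *)
Lemma ge0_le_integral_subset (A B : set T) (f g : T -> \bar R) : A `<=` B ->
  (forall x, A x -> 0 <= f x) -> (forall x, B x -> 0 <= g x) ->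
  (forall x, A x -> f x <= g x) ->
  \int[mu]_(x in A) f x <= \int[mu]_(x in B) g x.
Proof.
move=> AB f0 g0 fg; rewrite integral_mkcond [leRHS]integral_mkcond.
have fA0 x : 0 <= (f \_ A) x by exact: erestrict_ge0.
have gB0 x : 0 <= (g \_ B) x by exact: erestrict_ge0.
rewrite !ge0_integralTE//; apply: ereal_sup_le => _ [h hf <-]; exists h => // x.
apply: le_trans (hf x) _; rewrite !patchE; case: ifPn => [|_]; last first.
  by case: ifPn => // /set_mem /g0.
by move=> /set_mem Ax; rewrite mem_set ?fg//; exact: AB.
Qed.

End MonotoneIntegral.

Section FlatFunctions.
Context {R : realType}.
Implicit Types (P Q q : {poly R}) (x : R).

Definition flat P x : R := if 0 < x then P.[x^-1] * expR (- x^-1) else 0.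

Lemma exprn_expRN_le (u : R) n : 0 <= u -> u ^+ n * expR (- u) <= n`!%:R.
Proof.
move=> u0; rewrite expRN ler_pdivrMr ?expR_gt0//.
case: n => [|n]; first by rewrite expr0 fact0 mul1r -expR0 ler_expR.
have : u ^+ n.+1 / (n.+1)`!%:R <= expR u.
  by apply: le_trans (expR_ge1Dxn n u0); rewrite lerDr.
by rewrite ler_pdivrMr// mulrC.
Qed.

Lemma flat_le_sqr P : exists2 C, 0 <= C & forall x, `|flat P x| <= C * x ^+ 2.
Proof.
pose C : R := \sum_(i < size P) `|P`_i| * (i.+2)`!%:R.
have C0 : 0 <= C by apply: sumr_ge0 => i _; rewrite mulr_ge0// ler0n.
exists C => // x; rewrite /flat; case: ifPn => [x0|_]; last first.
  by rewrite normr0 mulr_ge0// sqr_ge0.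
have u0 : 0 < x^-1 by rewrite invr_gt0.
rewrite -ler_pdivrMr ?exprn_gt0// -exprVn normrM (ger0_norm (expR_ge0 _)).
rewrite horner_coef.
apply: (@le_trans _ _ ((\sum_(i < size P) `|P`_i| * x^-1 ^+ i) *
    expR (- x^-1) * x^-1 ^+ 2)).
  rewrite ler_wpM2r ?sqr_ge0// ler_wpM2r ?expR_ge0//.
  apply: (le_trans (ler_norm_sum _ _ _)); apply: ler_sum => i _.
  by rewrite normrM (ger0_norm (exprn_ge0 _ (ltW u0))).
rewrite -mulrA mulr_suml; apply: ler_sum => i _.
rewrite -mulrA ler_wpM2l// [expR _ * _]mulrC mulrA -exprD addn2.
by apply: exprn_expRN_le; exact: ltW.
Qed.

Definition flat_deriv P : {poly R} := 'X^2 * (P - P^`()).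

Lemma is_derive_flat_gt0 P x : 0 < x ->
  is_derive x 1 (flat P) (flat (flat_deriv P) x).
Proof.
move=> x0; rewrite {2}/flat x0.
apply: (@near_eq_is_derive _ _ _
    ((horner P \o (fun y : R => y^-1)) * (expR \o (fun y => - y^-1)))).
  near=> y; rewrite /flat ifT//.
  by near: y; exact: lt_nbhsr.
have dV : is_derive x 1 (fun y : R => y^-1) (- x ^- 2 *: (1 : R)).
  by apply: (@is_deriveV _ id) => //; rewrite gt_eqF.
have dP := is_derive1_comp (is_derive_poly P x^-1) dV.
have dN : is_derive x 1 (fun y : R => - y^-1) (x ^- 2).
  by apply: is_derive_eq (is_deriveN dV) _; rewrite /GRing.scale/= mulr1 opprK.
have dE := @is_derive1_comp _ _ (fun y => - y^-1) _ _ _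
  (is_derive_expR (- x^-1)) dN.
apply: is_derive_eq (is_deriveM dP dE) _.
by rewrite /= /flat_deriv !hornerE /= /GRing.scale/= -exprVn; ring.
Unshelve. all: by end_near. Qed.

Lemma is_derive_flat0 P : is_derive (0 : R) 1 (flat P) 0.
Proof.
have [C C0 PC] := flat_le_sqr P.
have quo0 : (h^-1 *: (flat P (h *: (1:R) + 0) - flat P 0)) @[h --> 0^'] -->
    (0 : R).
  apply/cvgr0Pnorm_lt => eps e0; near=> h.
  have h0 : h != 0 by near: h; exact: nbhs_dnbhs_neq.
  rewrite {2}/flat ltxx subr0 addr0 /GRing.scale/= mulr1 normrM normfV.
  rewrite mulrC ltr_pdivrMr ?normr_gt0//; apply: le_lt_trans (PC h) _.
  rewrite -(real_normK (num_real h)) expr2 mulrA ltr_pM2r ?normr_gt0//.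
  have : `|h| < eps / (C + 1).
    by near: h; apply: dnbhs0_lt; rewrite divr_gt0// ltr_pwDr.
  rewrite ltr_pdivlMr ?ltr_pwDr//.
  by have := normr_ge0 h; nra.
apply: DeriveDef; last exact: cvg_lim quo0.
by apply/cvg_ex; exists 0; exact: quo0.
Unshelve. all: by end_near. Qed.

Lemma is_derive_flat P x : is_derive x 1 (flat P) (flat (flat_deriv P) x).
Proof.
have [x0|x0|->] := ltgtP x 0; last 2 first.
- exact: is_derive_flat_gt0.
- by rewrite {2}/flat ltxx; exact: is_derive_flat0.
rewrite {2}/flat ltNge (ltW x0)/=.
apply: (@near_eq_is_derive _ _ _ (cst 0)).
near=> y; rewrite /flat ifF//; apply/negbTE; rewrite -leNgt ltW//.
by near: y; exact: lt_nbhsl.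
Unshelve. all: by end_near. Qed.

Lemma flat1_ge0_le1 x : 0 <= flat 1 x <= 1.
Proof.
rewrite /flat; case: ifPn => [x0|_]; last by rewrite lexx ler01.
by rewrite hornerE mul1r expR_ge0 -expR0 ler_expR oppr_le0 invr_ge0 ltW.
Qed.

(* The span of the functions Q * (flat P \o q) is stable under differentiation, hence
   consists of smooth functions; it is not closed under products, so sums are needed. *)
Inductive flat_comb q : (R -> R) -> Prop :=
| flat_comb_gen P Q : flat_comb q (fun x => Q.[x] * flat P q.[x])
| flat_combD f g :
    flat_comb q f -> flat_comb q g -> flat_comb q (fun x => f x + g x).

Lemma flat_comb_derive q f : flat_comb q f ->
  exists2 g, flat_comb q g & forall x, is_derive x 1 f (g x).
Proof.
elim=> {f} [P Q|f g _ [f' bf df] _ [g' bg dg]]; last first.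
  exists (fun x => f' x + g' x); first exact: flat_combD.
  by move=> x; exact: is_deriveD (df x) (dg x).
exists (fun x => Q^`().[x] * flat P q.[x] +
    (Q * q^`()).[x] * flat (flat_deriv P) q.[x]).
  by apply: flat_combD; exact: flat_comb_gen.
move=> x; have dq := is_derive1_comp (is_derive_flat P q.[x]) (is_derive_poly q x).
apply: is_derive_eq (is_deriveM (is_derive_poly Q x) dq) _.
by rewrite hornerM /= /GRing.scale/=; ring.
Qed.

Lemma flat_comb_derivable q f n x :
  flat_comb q f -> derivable (derive1n n f) x 1.
Proof.
move=> bf; suff [g _ /(_ x)[]] : exists2 g, flat_comb q g &
  forall x, is_derive x 1 (derive1n n f) (g x) by [].
apply: flat_comb_derive; elim: n => [|n /flat_comb_derive[g bg dg]].
  by rewrite derive1n0.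
rewrite derive1nS (_ : derive1 _ = g)//; apply/funext => y.
by rewrite derive1E; apply: derive_val.
Qed.

End FlatFunctions.

Section TestFunctions.
Context {R : realType}.
Local Notation mu := (@lebesgue_measure R).
Implicit Types (phi rho u : R -> R).

Lemma test_fun_derivable phi x : test_fun phi -> derivable phi x 1.
Proof. by move=> [/(_ 0%N x) + _]; rewrite derive1n0. Qed.

Lemma test_fun_continuous phi : test_fun phi -> continuous phi.
Proof.
move=> tphi x; apply: differentiable_continuous; apply/derivable1_diffP.
exact: test_fun_derivable.
Qed.

Lemma test_fun_derive1 phi : test_fun phi -> test_fun (derive1 phi).
Proof.
move=> [dphi [M phi0]]; split.
  by move=> n x; rewrite -derive1Sn; exact: dphi.
exists M => x Mx; rewrite derive1E.
have : is_derive x 1 phi 0; last by case.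
apply: (@near_eq_is_derive _ _ _ (cst 0)); near=> y; rewrite phi0//; near: y.
exact: (cvgr_gt `|x| (@norm_continuous _ R x)).
Unshelve. all: by end_near. Qed.

Lemma test_funB phi rho : test_fun phi -> test_fun rho ->
  test_fun (fun x => phi x - rho x).
Proof.
move=> [dphi [M phi0]] [drho [N rho0]]; split.
  suff dE n : derive1n n (fun x => phi x - rho x) =
      (fun x => derive1n n phi x - derive1n n rho x).
    by move=> n x; rewrite dE; apply: derivableB; [exact: dphi|exact: drho].
  elim: n => [|n IH]; first by rewrite !derive1n0.
  by rewrite derive1nS IH; apply/funext => x; rewrite !derive1nS !derive1E deriveB.
exists (Num.max M N) => x; rewrite gt_max => /andP[Mx Nx].
by rewrite phi0// rho0// subrr.
Qed.

Lemma test_fun_bounded phi : test_fun phi -> exists M, forall x, `|phi x| <= M.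
Proof.
move=> tphi; have [_ [N phi0]] := tphi.
have := @continuous_compact _ _ phi `[- N, N]%classic
  (continuous_subspaceT (test_fun_continuous tphi)) (@segment_compact _ _ _).
move=> /compact_bounded[M [_ bnd]].
exists (`|M| + 1) => x; have [xN|Nx] := leP `|x| N.
  apply: (bnd (`|M| + 1)); first by have := ler_norm M; lra.
  by exists x => //=; rewrite in_itv/= -ler_norml.
by rewrite phi0// normr0 addr_ge0.
Qed.

Lemma locally_integrable_itv u (a b : R) :
  locally_integrable setT u -> mu.-integrable `[a, b] (EFin \o u).
Proof.
move=> [meas_u _ locu]; apply/integrableP; split.
  by apply/measurable_EFinP; exact: measurable_funS meas_u.
by apply: locu => //; exact: segment_compact.
Qed.

Lemma integrable_locally_test_fun u phi : locally_integrable setT u ->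
  test_fun phi -> mu.-integrable setT (EFin \o (fun x => u x * phi x)).
Proof.
move=> locu tphi; have [M phiM] := test_fun_bounded tphi.
have [_ [N phi0]] := tphi.
have mphi : measurable_fun setT phi.
  exact: continuous_measurable_fun (test_fun_continuous tphi).
apply: (@le_integrable _ _ _ mu setT measurableT _
    ((fun x => M%:E * (u x)%:E)%E \_ `[- N, N])).
- by apply/measurable_EFinP; apply: measurable_funM => //; case: locu.
- move=> x _; rewrite patchE; case: ifPn => [_|xN].
    rewrite lee_fin !normrM mulrC ler_wpM2r//.
    by apply: le_trans (phiM x) _; exact: ler_norm.
  rewrite /= phi0 ?mulr0 ?normr0// ltNge ler_norml.
  by move: xN; rewrite notin_setE/= in_itv/= => /negP.
- apply/(@integrable_mkcond _ _ _ mu `[- N, N] (fun x => M%:E * (u x)%:E)%E) => //.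
  by apply: integrableZl => //; exact: locally_integrable_itv.
Qed.

Lemma integrable_test_fun phi : test_fun phi ->
  mu.-integrable setT (EFin \o phi).
Proof.
move=> tphi; have loc1 : locally_integrable setT (\1_setT : R -> R).
  by apply: locally_integrable_indic => //; exact: openT.
apply: eq_integrable (integrable_locally_test_fun loc1 tphi) => // x _ /=.
by rewrite indicT mul1r.
Qed.

Lemma test_fun_support phi : test_fun phi -> exists2 M, 0 < M &
  forall x, M <= `|x| -> phi x = 0 /\ derive1 phi x = 0.
Proof.
move=> tphi; have [_ [M phi0]] := tphi.
have [_ [N dphi0]] := test_fun_derive1 tphi.
have M0 := normr_ge0 M; have N0 := normr_ge0 N.
have MM := ler_norm M; have NN := ler_norm N.
exists (`|M| + `|N| + 1) => [|x Mx]; first by rewrite ltr_pwDr ?addr_ge0.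
by split; [apply: phi0|apply: dphi0]; lra.
Qed.

Lemma integral_derive1_test_fun phi x : test_fun phi ->
  (\int[mu]_(y in `[x, +oo[) (derive1 phi y)%:E = (- phi x)%:E)%E.
Proof.
move=> tphi; have [M M0 phi0] := test_fun_support tphi.
have cphi := test_fun_continuous tphi.
pose B := `|x| + M.
have xB : x < B by have := ler_norm x; rewrite /B; lra.
have MB : M <= B by rewrite lerDr.
have phiB : phi B = 0 by have [] := phi0 B (le_trans MB (ler_norm B)).
transitivity (\int[mu]_(y in `[x, B]) (derive1 phi y)%:E)%E; last first.
  rewrite (continuous_FTC2 xB (F := phi)) ?phiB ?sub0e//.
  - exact: continuous_subspaceT (test_fun_continuous (test_fun_derive1 tphi)).
  - split; first by move=> y _; exact: test_fun_derivable.
      by apply: cvg_at_right_filter; exact: cphi.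
    by apply: cvg_at_left_filter; exact: cphi.
rewrite integral_mkcond [RHS]integral_mkcond; apply: eq_integral => y _.
rewrite !patchE; case: ifPn => yx; case: ifPn => // yB.
- rewrite (phi0 y _).2//; apply: le_trans MB _; rewrite leNgt; apply/negP => yltB.
  move/negP: yB; apply; move: yx; rewrite !inE/= !in_itv/= andbT => ->/=.
  by rewrite ltW// (le_lt_trans (ler_norm y)).
- by move: yx yB; rewrite notin_setE inE/= !in_itv/= andbT => + /andP[].
Qed.

Lemma integral_derive1_test_fun0 phi : test_fun phi ->
  (\int[mu]_y (derive1 phi y)%:E = 0)%E.
Proof.
move=> tphi; have [M M0 phi0] := test_fun_support tphi.
have := integral_derive1_test_fun (- M) tphi.
rewrite (phi0 _ _).1 ?normrN ?gtr0_norm// oppr0 => int0; rewrite -[RHS]int0.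
rewrite [RHS]integral_mkcond; apply: eq_integral => y _.
rewrite patchE; case: ifPn => //; rewrite notin_setE/= in_itv/= andbT => /negP.
by rewrite -ltNge => yM; rewrite (phi0 y _).2// ler_normr lerNr (ltW yM) orbT.
Qed.

Lemma test_fun_primitive rho : test_fun rho -> (\int[mu]_x (rho x)%:E = 0)%E ->
  exists2 phi, test_fun phi & derive1 phi = rho.
Proof.
move=> trho rho_int0; have irho := integrable_test_fun trho.
have [drho [M rho0]] := trho.
pose phi x := \int[mu]_(y in `]-oo, x]) rho y.
have dphi (x : R) : is_derive x 1 phi (rho x).
  have irhox : mu.-integrable `]-oo, (x + 1)%R] (EFin \o rho).
    exact: integrableS irho.
  have xx1 : x < x + 1 by rewrite ltrDl.
  have [dF <-] := continuous_FTC1 xx1 irhox (ltNyr _) (@test_fun_continuous _ trho x).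
  by rewrite derive1E; apply: DeriveDef.
have phiE : derive1 phi = rho.
  by apply/funext => x; rewrite derive1E; apply: derive_val.
exists phi; last exact: phiE.
split.
  case=> [|n] x; last by rewrite derive1Sn phiE.
  by rewrite derive1n0; have [] := dphi x.
exists (`|M| + 1) => x Mx; have xneg := ler_norm (- x).
rewrite normrN in xneg; have MM := ler_norm M.
rewrite /phi /Rintegral.
move: Mx; rewrite lter_normr => /orP[] Mx.
- rewrite (_ : \int[mu]_(y in _) _ = 0)%E// -rho_int0 integral_mkcond.
  apply: eq_integral => y _; rewrite patchE; case: ifPn => //.
  rewrite notin_setE/= in_itv/= => /negP; rewrite -ltNge => xy.
  by rewrite rho0//; have := ler_norm y; lra.
- rewrite integral0_eq// => y /=; rewrite in_itv/= => yx.
  by rewrite rho0//; have := ler_norm (- y); rewrite normrN; lra.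
Qed.

Definition bump_poly (a e : R) : {poly R} :=
  e ^- 2 *: (('X - a%:P) * ((a + e)%:P - 'X)).

Lemma horner_bump_poly (a e x : R) :
  (bump_poly a e).[x] = e ^- 2 * ((x - a) * (a + e - x)).
Proof. by rewrite /bump_poly hornerZ hornerM !hornerE. Qed.

Definition bump (a e x : R) : R := flat 1 (bump_poly a e).[x].

Lemma bump_ge0_le1 (a e x : R) : 0 <= bump a e x <= 1.
Proof. exact: flat1_ge0_le1. Qed.

Lemma bump_eq0 (a e x : R) : 0 < e -> ~~ (a < x < a + e) -> bump a e x = 0.
Proof.
move=> e0 xae; rewrite /bump /flat ifF// horner_bump_poly; apply/negbTE.
rewrite -leNgt pmulr_rle0 ?invr_gt0 ?exprn_gt0//.
move: xae; rewrite negb_and -!leNgt => /orP[xa|xa].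
  by rewrite mulr_le0_ge0 ?subr_le0// subr_ge0 (le_trans xa)// lerDl ltW.
by rewrite mulr_ge0_le0 ?subr_le0// subr_ge0 (le_trans _ xa)// lerDl ltW.
Qed.

Lemma bump_ge (a e x : R) : 0 < e ->
  a + e / 3 <= x <= a + e / 3 + e / 3 ->
  expR (- (9 / 2)) <= bump a e x.
Proof.
move=> e0 /andP[ax xa]; rewrite /bump horner_bump_poly.
have mid : e ^- 2 * (2 / 9 * e ^+ 2) <= e ^- 2 * ((x - a) * (a + e - x)).
  by rewrite ler_wpM2l ?invr_ge0 ?sqr_ge0//; nra.
have {}mid : 2 / 9 <= e ^- 2 * ((x - a) * (a + e - x)).
  by apply: le_trans mid; rewrite mulrCA mulVf ?mulr1// expf_neq0// gt_eqF.
rewrite /flat (lt_le_trans _ mid) ?divr_gt0// hornerE mul1r ler_expR lerN2.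
by rewrite (_ : 9 / 2 = (2 / 9)^-1) ?lef_pV2 ?posrE ?(lt_le_trans _ mid) ?divr_gt0//; field.
Qed.

Lemma test_fun_bump (a e k : R) : 0 < e -> test_fun (fun x => k * bump a e x).
Proof.
move=> e0; have comb := flat_comb_gen (bump_poly a e) 1 k%:P.
rewrite (_ : (fun x => k * _) = (fun x => k%:P.[x] * flat 1 (bump_poly a e).[x])).
  split; first by move=> n x; exact: flat_comb_derivable comb.
  exists (`|a| + e) => x xM; rewrite [flat _ _]bump_eq0 ?mulr0//.
  apply/negP => /andP[ax xae].
  have a1 := ler_norm a; have a2 := ler_norm (- a); rewrite normrN in a2.
  by move: xM; rewrite lter_normr => /orP[xa|xa]; lra.
by apply/funext => x; rewrite hornerC.
Qed.

Lemma integral_bump_ge (a e : R) : 0 < e ->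
  ((expR (- (9 / 2)) * (e / 3))%:E <= \int[mu]_x (bump a e x)%:E)%E.
Proof.
move=> e0; pose I := `[a + e / 3, a + e / 3 + e / 3]%classic.
have mI : measurable I by exact: measurable_itv.
rewrite (_ : _%:E = \int[mu]_(x in I) (expR (- (9 / 2)))%:E)%E.
  apply: ge0_le_integral_subset => // x; rewrite ?lee_fin ?expR_ge0//.
    by move=> _; case/andP: (bump_ge0_le1 a e x).
  by rewrite /I/= in_itv/= => xI; exact: bump_ge.
rewrite integral_cst//= lebesgue_measure_itv/= lte_fin ltrDl divr_gt0//.
by rewrite -EFinB -EFinM addrAC subrr add0r.
Qed.

Lemma unit_mass_bump : exists2 C : R, 0 < C & forall a e : R, 0 < e ->
  exists rho, [/\ test_fun rho, (\int[mu]_x (rho x)%:E = 1)%E,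
    forall x, 0 <= rho x <= C / e & forall x, ~~ (a < x < a + e) -> rho x = 0].
Proof.
pose k : R := expR (- (9 / 2)); have k0 : 0 < k by exact: expR_gt0.
exists (3 / k); first by rewrite divr_gt0.
move=> a e e0; have /= tbump := test_fun_bump a 1 e0.
have ibump : mu.-integrable setT (EFin \o bump a e).
  by apply: eq_integrable (integrable_test_fun tbump) => // x _ /=; rewrite mul1r.
pose c := \int[mu]_x bump a e x.
have cE : (\int[mu]_x (bump a e x)%:E = c%:E)%E.
  by rewrite /c /Rintegral fineK//; exact: integrable_fin_num ibump.
have kc : k * (e / 3) <= c by rewrite -lee_fin -cE; exact: integral_bump_ge.
have c0 : 0 < c by apply: lt_le_trans kc; rewrite mulr_gt0// divr_gt0.
exists (fun x => c^-1 * bump a e x); split => //.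
- exact: test_fun_bump.
- under eq_integral do rewrite EFinM.
  by rewrite integralZl ?cE -?EFinM ?mulVf ?gt_eqF.
- move=> x; have /andP[b0 b1] := bump_ge0_le1 a e x.
  rewrite mulr_ge0 ?invr_ge0 ?(ltW c0)//=.
  apply: (@le_trans _ _ c^-1); first by rewrite ler_piMr// invr_ge0 ltW.
  have -> : 3 / k / e = (k * (e / 3))^-1 by field; rewrite !gt_eqF.
  by rewrite lef_pV2// posrE// mulr_gt0// divr_gt0.
- by move=> x xae; rewrite bump_eq0 ?mulr0.
Qed.

End TestFunctions.

Section WeakDerivatives.
Context {R : realType}.
Local Notation mu := (@lebesgue_measure R).
Implicit Types (f g u rho : R -> R).

Lemma weak_derivB f df g dg : weak_deriv f df -> weak_deriv g dg ->
  weak_deriv (fun x => f x - g x) (fun x => df x - dg x).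
Proof.
move=> [lf [ldf wf]] [lg [ldg wg]].
split; first exact: locally_integrableB.
split; first exact: locally_integrableB.
move=> phi tphi; have tdphi := test_fun_derive1 tphi.
have intB u v w : locally_integrable setT u -> locally_integrable setT v ->
    test_fun w -> (\int[mu]_x ((u x - v x) * w x)%:E =
    \int[mu]_x (u x * w x)%:E - \int[mu]_x (v x * w x)%:E)%E.
  move=> lu lv tw; rewrite -integralB//; last 2 first.
  - exact: integrable_locally_test_fun.
  - exact: integrable_locally_test_fun.
  by apply: eq_integral => x _; rewrite mulrBl.
rewrite !intB// wf// wg// oppeB ?oppeK// fin_num_adde_defr// ?fin_numN.
by apply: integrable_fin_num => //; exact: integrable_locally_test_fun.
Qed.

Lemma bump_average_le_davg u rho (a e C : R) : 0 < e -> 0 <= C ->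
  locally_integrable setT u -> test_fun rho -> (\int[mu]_x (rho x)%:E = 1)%E ->
  (forall x, 0 <= rho x <= C / e) -> (forall x, ~~ (a < x < a + e) -> rho x = 0) ->
  (`|\int[mu]_x (u x * rho x)%:E - (u a)%:E| <= (2 * C)%:E * davg u a e)%E.
Proof.
move=> e0 C0 lu trho rho1 rhoC rho0.
have meas_u : measurable_fun setT u by case: lu.
have mrho : measurable_fun setT rho.
  exact: continuous_measurable_fun (test_fun_continuous trho).
have muB : measurable_fun setT (fun x => u x - u a) by exact: measurable_funB.
have -> : (\int[mu]_x (u x * rho x)%:E - (u a)%:E =
    \int[mu]_x ((u x - u a) * rho x)%:E)%E.
  have irho := integrable_test_fun trho.
  have -> : ((u a)%:E = \int[mu]_x ((u a)%:E * (EFin \o rho) x))%E.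
    by rewrite integralZl// rho1 mule1.
  rewrite -integralB//; last 2 first.
  - exact: integrable_locally_test_fun.
  - exact: integrableZl.
  by apply: eq_integral => x _ /=; rewrite mulrBl EFinB EFinM.
apply: le_trans (le_abse_integral _ measurableT _) _.
  by apply/measurable_EFinP; exact: measurable_funM.
have mdist : measurable_fun setT (fun x => `|(u x - u a)%:E|)%E.
  by apply: measurableT_comp => //; exact/measurable_EFinP.
have mball : measurable (ball a e) by exact: measurable_ball.
apply: (@le_trans _ _ (\int[mu]_(x in ball a e) ((C / e)%:E * `|(u x - u a)%:E|))%E).
  rewrite integral_mkcond [leRHS]integral_mkcond patch_setT.
  apply: ge0_le_integral_subset => // x _.
    by apply: erestrict_ge0 => y _; rewrite mule_ge0// lee_fin divr_ge0// ltW.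
  have /andP[r0 r1] := rhoC x; rewrite patchE; case: ifPn => [_|xI].
    by rewrite /= lee_fin normrM (ger0_norm r0) mulrC ler_wpM2r.
  rewrite rho0 ?mulr0 ?abse0//; apply/negP => /andP[ax xae].
  by move: xI; rewrite notin_setE /ball/= => /negP; rewrite ltr_norml; lra.
rewrite ge0_integralZl_EFin//; last 2 first.
- exact: measurable_funS mdist.
- by rewrite divr_ge0// ltW.
rewrite /davg /iavg lebesgue_measure_ball; last exact: ltW.
rewrite muleA inver ifF; last by rewrite mulrn_eq0/= gt_eqF.
rewrite -EFinM (_ : 2 * C * _ = C / e)//.
by rewrite -mulr_natr; field; rewrite gt_eqF.
Qed.

(* The difference of two test functions of equal mass is the derivative of a test
   function. *)
Lemma weak_deriv0_average_eq u rho eta : weak_deriv u (cst 0) ->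
  test_fun rho -> test_fun eta ->
  (\int[mu]_x (rho x)%:E = \int[mu]_x (eta x)%:E)%E ->
  (\int[mu]_x (u x * rho x)%:E = \int[mu]_x (u x * eta x)%:E)%E.
Proof.
move=> [lu [_ wu]] trho teta mass.
have irho := integrable_locally_test_fun lu trho.
have ieta := integrable_locally_test_fun lu teta.
have [|phi tphi dphi] := test_fun_primitive (test_funB trho teta).
  under eq_integral do rewrite EFinB.
  rewrite integralB ?mass ?subee//; do ?exact: integrable_test_fun.
  exact: integrable_fin_num (integrable_test_fun teta).
rewrite -[RHS]add0e; apply/eqP; rewrite -sube_eq//; last exact: integrable_fin_num irho.
rewrite -integralB//; apply/eqP; have := wu _ tphi; rewrite dphi.
under [X in _ = (- X)%E]eq_integral do rewrite mul0r.
rewrite integral0 oppe0 => <-.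
by apply: eq_integral => x _ /=; rewrite mulrBr.
Qed.

Lemma weak_deriv0_lebesgue_pt_eq u (a b : R) : weak_deriv u (cst 0) ->
  lebesgue_pt u a -> lebesgue_pt u b -> u a = u b.
Proof.
move=> wu La Lb; have [lu _] := wu; have [C C0 bumps] := @unit_mass_bump R.
have dist_le e : 0 < e -> (`|(u a - u b)%:E| <=
    (2 * C)%:E * davg u a e + (2 * C)%:E * davg u b e)%E.
  move=> e0; have [rho [trho rho1 rhoC rho0]] := bumps a e e0.
  have [eta [teta eta1 etaC eta0]] := bumps b e e0.
  have lea := bump_average_le_davg e0 (ltW C0) lu trho rho1 rhoC rho0.
  have leb := bump_average_le_davg e0 (ltW C0) lu teta eta1 etaC eta0.
  rewrite (weak_deriv0_average_eq wu trho teta) ?rho1// in lea.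
  have fin := integrable_fin_num measurableT (integrable_locally_test_fun lu teta).
  apply: le_trans (leeD lea leb); rewrite -(fineK fin) -!EFinB/= -EFinD lee_fin.
  by rewrite [X in _ <= X + _]distrC; apply: ler_distD.
have : (`|(u a - u b)%:E| <= (2 * C)%:E * 0 + (2 * C)%:E * 0)%E.
  have cvg0 : ((2 * C)%:E * davg u a e + (2 * C)%:E * davg u b e)%E
      @[e --> 0^'+] --> ((2 * C)%:E * 0 + (2 * C)%:E * 0)%E.
    by apply: cvgeD; [rewrite !mule0|exact: cvgeZl|exact: cvgeZl].
  rewrite -(cvg_lim _ cvg0)//; apply: lime_ge.
    by apply/cvg_ex; eexists; exact: cvg0.
  by near=> e; apply: dist_le; near: e; exact: nbhs_right_gt.
by rewrite !mule0 adde0 /= lee_fin normr_le0 subr_eq0 => /eqP.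
Unshelve. all: by end_near. Qed.

End WeakDerivatives.

Section IntervalIntegrals.
Context {R : realType}.
Local Notation mu := (@lebesgue_measure R).
Implicit Types (h : R -> \bar R) (a b c : R).

Lemma integral_itv_cat h (x y : itv_bound R) c :
  (x <= BRight c)%O -> (BRight c <= y)%O ->
  measurable_fun [set` Interval x y] h ->
  (\int[mu]_(t in [set` Interval x y]) h t =
   \int[mu]_(t in [set` Interval x (BRight c)]) h t +
   \int[mu]_(t in [set` Interval (BLeft c) y]) h t)%E.
Proof.
move=> xc cy mh; rewrite -(@integral_itv_obnd_cbnd _ c y); last first.
  by apply: measurable_funS mh => //; exact: subset_itvr.
rewrite -integral_setU//=.
- by rewrite -itv_bndbnd_setU.
- by rewrite -itv_bndbnd_setU.
- apply/disj_setPS => t [] /=; rewrite !in_itv/= => /andP[_ tc] /andP[].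
  by rewrite ltNge tc.
Qed.

Lemma integral_cst_itv (k a b : R) : a <= b ->
  (\int[mu]_(x in `[a, b]) k%:E = (k * (b - a))%:E)%E.
Proof.
move=> ab; rewrite integral_cst//= lebesgue_measure_itv/= lte_fin.
move: ab; rewrite le_eqVlt => /predU1P[->|->]; last by rewrite -EFinB -EFinM.
by rewrite ltxx subrr mule0 mulr0.
Qed.

Lemma measurable_reflection c :
  measurable_fun setT ((fun x => c - x) : measurableTypeR R -> measurableTypeR R).
Proof. exact: measurable_funB. Qed.

Lemma lebesgue_measure_reflection c (A : set R) : measurable A ->
  pushforward mu ((fun x => c - x) : measurableTypeR R -> measurableTypeR R) A = mu A.
Proof.
move=> mA; apply/esym/lebesgue_measure_unique => //=; first exact: measurable_reflection.
move=> _ _ [[a b]] _ <-; rewrite /pushforward.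
rewrite (_ : _ @^-1` _ = `[c - b, c - a[%classic); last first.
  by apply/seteqP; split => x /=; rewrite !in_itv/= => /andP[? ?]; apply/andP; split; lra.
rewrite !lebesgue_measure_itv/= !lte_fin ltrD2l ltrN2; case: ifPn => // _.
by rewrite -!EFinB; congr EFin; ring.
Qed.

Lemma ge0_integral_reflect h c (A : set R) : measurable A ->
  measurable_fun setT h -> (forall x, 0 <= h x)%E ->
  (\int[mu]_(x in A) h x = \int[mu]_(x in (fun x => c - x)%R @^-1` A) h (c - x)%R)%E.
Proof.
move=> mA mh h0.
rewrite -(@ge0_integral_pushforward _ _ _ _ _ _ (measurable_reflection c) mu A h)//;
  last exact: measurable_funS mh.
apply: eq_measure_integral => //=; first exact: measurable_reflection.
by move=> _ B mB BA; exact/esym/lebesgue_measure_reflection.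
Qed.

Lemma integral_reflect h c (A : set R) : measurable A -> measurable_fun setT h ->
  (\int[mu]_(x in A) h x = \int[mu]_(x in (fun x => c - x)%R @^-1` A) h (c - x)%R)%E.
Proof.
move=> mA mh; rewrite integralE [RHS]integralE; congr (_ - _)%E.
- rewrite (ge0_integral_reflect c mA)//; [by rewrite unlock|exact: measurable_funepos].
- rewrite (ge0_integral_reflect c mA)//; [by rewrite unlock|exact: measurable_funeneg].
Qed.

Lemma preimage_reflect_itvcc c a b :
  (fun x => c - x) @^-1` `[a, b] = `[c - b, c - a]%classic.
Proof.
by apply/seteqP; split => x /=; rewrite !in_itv/= => /andP[? ?]; apply/andP; split; lra.
Qed.

Lemma preimage_reflect_itvNyc c a :
  (fun x => c - x) @^-1` `]-oo, a] = `[c - a, +oo[%classic.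
Proof. by apply/seteqP; split => x /=; rewrite !in_itv/= ?andbT => ?; lra. Qed.

End IntervalIntegrals.

Section AbsolutelyContinuous.
Context {R : realType}.
Local Notation mu := (@lebesgue_measure R).
Implicit Types (f D : R -> R) (a b c : R).

Definition ac_deriv_on f D a b :=
  mu.-integrable `[a, b] (EFin \o D) /\
  (f b - f a)%:E = (\int[mu]_(x in `[a, b]) (D x)%:E)%E.

Definition ac_deriv f D := forall a b, a <= b -> ac_deriv_on f D a b.

Lemma eq_ac_deriv_on f1 D1 f2 D2 a b : f1 a = f2 a -> f1 b = f2 b ->
  {in `]a, b[, D1 =1 D2} -> ac_deriv_on f1 D1 a b -> ac_deriv_on f2 D2 a b.
Proof.
move=> fa fb D12 [iD1 fE].
have sub : `]a, b[%classic `<=` `[a, b] by exact: subset_itv_oo_cc.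
have iD1o : mu.-integrable `]a, b[ (EFin \o D1) by exact: integrableS iD1.
have iD2o : mu.-integrable `]a, b[ (EFin \o D2).
  by apply: eq_integrable iD1o => // x; rewrite inE /= => /D12 ->.
have mD2o := measurable_int _ iD2o; have mD1o := measurable_int _ iD1o.
split; last first.
  rewrite -fa -fb fE integral_itv_bndoo// [RHS]integral_itv_bndoo//.
  by apply: eq_integral => x; rewrite inE/= => /D12 ->.
apply/integrableP; split; first exact: emeasurable_fun_itv_cc mD2o.
rewrite integral_itv_bndoo; first by case/integrableP: iD2o.
exact: measurableT_comp.
Qed.

Lemma ac_deriv_on_cat f D a b c : a <= c -> c <= b ->
  ac_deriv_on f D a c -> ac_deriv_on f D c b -> ac_deriv_on f D a b.
Proof.
move=> ac cb [iac fac] [icb fcb].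
have mab : measurable_fun `[a, b] (EFin \o D).
  rewrite (@itv_bndbnd_setU _ _ _ (BRight c)) ?bnd_simp//.
  apply/measurable_funU => //; split; first exact: measurable_int iac.
  apply: measurable_funS (measurable_int _ icb) => //.
  by apply: subset_itvr; rewrite bnd_simp.
split; last first.
  rewrite (@integral_itv_cat _ _ _ _ c)//= -fac -fcb -EFinD; congr EFin; ring.
apply/integrableP; split => //.
rewrite (@integral_itv_cat _ _ _ _ c)//; last exact: measurableT_comp.
by apply: lte_add_pinfty; [case/integrableP: iac|case/integrableP: icb].
Qed.

Lemma ac_deriv_measurable f D : ac_deriv f D -> measurable_fun setT D.
Proof.
move=> acf; rewrite -(bigcup_itvT true false); apply/measurable_fun_bigcup => // n.
have [iD _] : ac_deriv_on f D (- n%:R) n%:R.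
  by apply: acf; rewrite (@le_trans _ _ 0) ?oppr_le0.
by apply/measurable_EFinP; exact: measurable_int iD.
Qed.

Lemma ac_deriv_continuous f D : ac_deriv f D -> continuous f.
Proof.
move=> acf x; have x1 : x - 1 < x + 1 by lra.
have [iD _] := acf _ _ (ltW x1).
have /(continuous_within_itvP _ x1)[+ _ _] :=
  parameterized_integral_continuous (ltW x1) iD.
have xI : x \in `]x - 1, x + 1[ by rewrite in_itv/=; apply/andP; split; lra.
move=> /(_ x xI) cint.
have csum : f (x - 1) + parameterized_integral mu (x - 1) y D @[y --> x] -->
    f (x - 1) + parameterized_integral mu (x - 1) x D.
  by apply: cvgD => //; exact: cvg_cst.
have fE y : x - 1 <= y -> f y = f (x - 1) + parameterized_integral mu (x - 1) y D.
  move=> xy; have [_ /(congr1 fine)/=] := acf _ _ xy.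
  by rewrite /parameterized_integral /Rintegral => <-; rewrite addrC subrK.
rewrite /continuous_at fE; last by lra.
apply: cvg_trans csum; apply: near_eq_cvg; near=> y.
by rewrite -fE//; apply: ltW; near: y; apply: lt_nbhsr; lra.
Unshelve. all: by end_near. Qed.

Lemma ac_deriv_measurable_fun f D : ac_deriv f D -> measurable_fun setT f.
Proof. by move=> /ac_deriv_continuous; exact: continuous_measurable_fun. Qed.

Lemma ac_deriv_affine (h p c : R) : ac_deriv (fun x => h + p * (x - c)) (cst p).
Proof.
move=> a b ab; split.
  apply: continuous_compact_integrable; first exact: segment_compact.
  by apply: continuous_subspaceT => x; exact: cvg_cst.
by rewrite integral_cst_itv//; congr EFin; ring.
Qed.

Lemma ac_deriv_cst (h : R) : ac_deriv (cst h) (cst 0).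
Proof.
have := ac_deriv_affine h 0 0; rewrite (_ : (fun x => h + _) = cst h)//.
by apply/funext => x; rewrite mul0r addr0.
Qed.

Lemma ac_deriv_addr f D (k : R) : ac_deriv f D -> ac_deriv (fun x => f x + k) D.
Proof.
move=> acf a b ab; have [iD fE] := acf a b ab; split => //.
by rewrite -fE; congr EFin; ring.
Qed.

Lemma ac_derivN f D : ac_deriv f D -> ac_deriv (fun x => - f x) (fun x => - D x).
Proof.
move=> acf a b ab; have [iD fE] := acf a b ab; split.
  by apply: eq_integrable (integrableN iD).
rewrite -opprD EFinN fE -integralN.
  by apply: eq_integral => x _; rewrite EFinN.
by rewrite fin_num_adde_defl// fin_numN; exact: integrable_neg_fin_num.
Qed.

Lemma ac_deriv_reflect f D c : ac_deriv f D ->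
  ac_deriv (fun x => f (c - x)) (fun x => - D (c - x)).
Proof.
move=> acf; have mD : measurable_fun setT (EFin \o D).
  by apply/measurable_EFinP; exact: ac_deriv_measurable acf.
suff refl : ac_deriv (fun x => - f (c - x)) (fun x => D (c - x)).
  by have := ac_derivN refl; under [X in ac_deriv X]eq_fun do rewrite opprK.
move=> a b ab; have [iD fE] := acf (c - b) (c - a) (lerB (lexx c) ab).
have intE := integral_reflect c (measurable_itv `[c - b, c - a]).
rewrite preimage_reflect_itvcc !subKr in intE; split; last first.
  by rewrite -(intE (EFin \o D))// -fE opprK addrC.
apply/integrableP; split.
  by apply: measurable_funTS; exact: measurableT_comp mD (measurable_reflection c).
case/integrableP: iD => _; rewrite (intE (fun x => `|(D x)%:E|)%E)//.
exact: measurableT_comp.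
Qed.

Definition glue {T : Type} c (f1 f2 : R -> T) (x : R) := if x <= c then f1 x else f2 x.

Lemma glue_ge {T : Type} c (f1 f2 : R -> T) x : f1 c = f2 c -> c <= x -> glue c f1 f2 x = f2 x.
Proof.
by move=> fc; rewrite /glue le_eqVlt leNgt => /predU1P[<-|->]; rewrite ?ltxx ?fc.
Qed.

Lemma measurable_glue d (T : measurableType d) c (f1 f2 : R -> T) :
  measurable_fun setT f1 -> measurable_fun setT f2 ->
  measurable_fun setT (glue c f1 f2).
Proof. by move=> m1 m2; apply: measurable_fun_ifT => //; exact: measurable_fun_ler. Qed.

Lemma integral_glue_le (h1 h2 : R -> \bar R) (x : itv_bound R) b c : b <= c ->
  (\int[mu]_(t in [set` Interval x (BRight b)]) glue c h1 h2 t =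
   \int[mu]_(t in [set` Interval x (BRight b)]) h1 t)%E.
Proof.
move=> bc; apply: eq_integral => t; rewrite inE/= in_itv/= => /andP[_ tb].
by rewrite /glue (le_trans tb).
Qed.

Lemma integral_glue (h1 h2 : R -> \bar R) (x y : itv_bound R) c :
  (x <= BRight c)%O -> (BRight c <= y)%O ->
  measurable_fun setT h1 -> measurable_fun setT h2 ->
  (\int[mu]_(t in [set` Interval x y]) glue c h1 h2 t =
   \int[mu]_(t in [set` Interval x (BRight c)]) h1 t +
   \int[mu]_(t in [set` Interval (BLeft c) y]) h2 t)%E.
Proof.
move=> xc cy m1 m2; have mglue := measurable_glue c m1 m2.
rewrite (integral_itv_cat xc cy); last exact: measurable_funS mglue.
rewrite integral_glue_le//; congr (_ + _)%E.
rewrite -[LHS]integral_itv_obnd_cbnd; last exact: measurable_funS mglue.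
rewrite -[RHS]integral_itv_obnd_cbnd; last exact: measurable_funS m2.
apply: eq_integral => t; rewrite inE/= in_itv/= => /andP[ct _].
by rewrite /glue leNgt ct.
Qed.

Lemma integral_glue_reflect (h : R -> \bar R) (c : R) :
  measurable_fun setT h -> (forall x, 0 <= h x)%E ->
  (\int[mu]_x glue c h (fun x => h (c + c - x)%R) x =
   \int[mu]_(x in `]-oo, c]) h x + \int[mu]_(x in `]-oo, c]) h x)%E.
Proof.
move=> mh h0; rewrite -set_itvNyy integral_glue//; last first.
  exact: measurableT_comp mh (measurable_reflection _).
congr (_ + _)%E; rewrite [RHS](ge0_integral_reflect (c + c))//.
by rewrite preimage_reflect_itvNyc addrK.
Qed.

Lemma ac_deriv_glue c f1 D1 f2 D2 : f1 c = f2 c ->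
  ac_deriv f1 D1 -> ac_deriv f2 D2 -> ac_deriv (glue c f1 f2) (glue c D1 D2).
Proof.
move=> fc ac1 ac2.
have left a b : a <= b -> b <= c -> ac_deriv_on (glue c f1 f2) (glue c D1 D2) a b.
  move=> ab bc; apply: eq_ac_deriv_on (ac1 a b ab); rewrite /glue ?bc ?(le_trans ab)//.
  by move=> x; rewrite in_itv/= => /andP[_ /ltW xb]; rewrite (le_trans xb).
have right a b : a <= b -> c <= a -> ac_deriv_on (glue c f1 f2) (glue c D1 D2) a b.
  move=> ab ca; apply: eq_ac_deriv_on (ac2 a b ab); rewrite ?glue_ge ?(le_trans ca)//.
  by move=> x; rewrite in_itv/= /glue leNgt => /andP[ax _]; rewrite (le_lt_trans ca).
move=> a b ab; have [bc|cb] := leP b c; first exact: left.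
have [ac|ca] := leP a c; last by exact: right (ltW ca).
by apply: (ac_deriv_on_cat ac (ltW cb)); [exact: left|exact: right (ltW cb) _].
Qed.

End AbsolutelyContinuous.

Section WeakAndAbsolutelyContinuous.
Context {R : realType}.
Local Notation mu := (@lebesgue_measure R).
Implicit Types (f D u v : R -> R).

Lemma integrable_prod_mul u v :
  mu.-integrable setT (EFin \o u) -> mu.-integrable setT (EFin \o v) ->
  (mu \x mu)%E.-integrable setT
    (fun p : measurableTypeR R * measurableTypeR R => (u p.1 * v p.2)%:E).
Proof.
move=> iu iv; set F := fun p => _.
have meas_u : measurable_fun setT u by apply/measurable_EFinP; exact: measurable_int iu.
have mv : measurable_fun setT v by apply/measurable_EFinP; exact: measurable_int iv.
have mF : measurable_fun setT F.
  apply/measurable_EFinP; apply: measurable_funM.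
    exact: measurableT_comp meas_u measurable_fst.
  exact: measurableT_comp mv measurable_snd.
apply: (proj2 (@integrable12ltyP _ _ _ _ R mu mu F mF)).
have [_ Uoo] := integrableP _ _ _ iu; have [_ Voo] := integrableP _ _ _ iv.
have mabsv : measurable_fun setT (fun x => `|(v x)%:E|)%E.
  by apply: measurableT_comp => //; exact/measurable_EFinP.
have mabsu : measurable_fun setT (fun x => `|(u x)%:E|)%E.
  by apply: measurableT_comp => //; exact/measurable_EFinP.
have innerE x : (\int[mu]_y `|F (x, y)| = `|(u x)%:E| * \int[mu]_y `|(v y)%:E|)%E.
  by rewrite -ge0_integralZl//; apply: eq_integral => y _; rewrite /F/= normrM.
under eq_integral do rewrite innerE.
rewrite ge0_integralZr//; last exact: integral_ge0.
have U0 : (0 <= \int[mu]_x `|(u x)%:E|)%E by exact: integral_ge0.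
by apply: lte_mul_pinfty => //; rewrite ge0_fin_numE.
Qed.

Lemma Fubini_half_plane u v :
  mu.-integrable setT (EFin \o u) -> mu.-integrable setT (EFin \o v) ->
  (\int[mu]_x ((u x)%:E * \int[mu]_(y in `[x, +oo[) (v y)%:E) =
   \int[mu]_y ((v y)%:E * \int[mu]_(x in `]-oo, y]) (u x)%:E))%E.
Proof.
move=> iu iv; have iuv := integrable_prod_mul iu iv.
pose F (p : measurableTypeR R * measurableTypeR R) : \bar R :=
  if p.1 <= p.2 then (u p.1 * v p.2)%:E else 0%E.
have iF : (mu \x mu)%E.-integrable setT F.
  apply: le_integrable iuv => //; last first.
    by move=> p _; rewrite /F; case: ifP => // _; rewrite abse0 abse_ge0.
  apply: measurable_fun_ifT => //; last exact: measurable_int (integrable_prod_mul iu iv).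
  by apply: measurable_fun_ler; [exact: measurable_fst|exact: measurable_snd].
transitivity (\int[mu]_x \int[mu]_y F (x, y))%E.
  apply: eq_integral => x _; rewrite -integralZl//; last exact: integrableS iv.
  rewrite integral_mkcond; apply: eq_integral => y _.
  by rewrite /F patchE mem_setE in_itv/= andbT; case: ifP => // _; rewrite EFinM.
rewrite (Fubini iF); apply: eq_integral => y _.
rewrite -integralZl//; last exact: integrableS iu.
rewrite [RHS]integral_mkcond; apply: eq_integral => x _.
by rewrite /F patchE mem_setE in_itv/=; case: ifP => // _; rewrite mulrC EFinM.
Qed.

Lemma ac_deriv_locally_integrable f D : ac_deriv f D ->
  locally_integrable setT f /\ locally_integrable setT D.
Proof.
move=> acf; have mD := ac_deriv_measurable acf.
split; split; [exact: ac_deriv_measurable_fun acf|exact: openT| |by []|exact: openT|].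
  move=> K _ cK; suff /integrableP[] : mu.-integrable K (EFin \o f) by [].
  apply: continuous_compact_integrable => //.
  exact: continuous_subspaceT (ac_deriv_continuous acf).
move=> K _ cK; have [M [_ KM]] := compact_bounded cK.
pose B := `|M| + 1; have B0 : - B <= B by rewrite ge0_cp// addr_ge0.
have KB : K `<=` `[- B, B]%classic.
  move=> x Kx; rewrite /= in_itv/= -ler_norml; apply: (KM B) => //.
  by rewrite /B; have := ler_norm M; lra.
have [/integrableP[_ iD] _] := acf _ _ B0.
by apply: le_lt_trans iD; exact: ge0_le_integral_subset.
Qed.

Lemma ac_deriv_integral_restrict f D a b y : ac_deriv f D -> a <= y -> y <= b ->
  (\int[mu]_(x in `]-oo, y]) ((D \_ `[a, b]) x)%:E = (f y - f a)%:E)%E.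
Proof.
move=> acf ay yb; have [_ ->] := acf _ _ ay.
rewrite integral_mkcond [RHS]integral_mkcond; apply: eq_integral => x _.
rewrite !patchE !mem_setE !in_itv/=; case: (leP x y) => [xy|_].
  by rewrite (le_trans xy yb) andbT; case: ifP.
by rewrite andbF.
Qed.

Lemma ac_deriv_weak f D : ac_deriv f D -> weak_deriv f D.
Proof.
move=> acf; have [lf lD] := ac_deriv_locally_integrable acf.
split => //; split => // phi tphi; have tdphi := test_fun_derive1 tphi.
have [M M0 phi0] := test_fun_support tphi.
have MM : - M <= M by rewrite ge0_cp// ltW.
pose J : set R := `[- M, M]%classic.
have mJ : measurable J by exact: measurable_itv.
have outJ x : x \notin J -> phi x = 0 /\ derive1 phi x = 0.
  move=> xJ; apply: phi0; rewrite leNgt; apply/negP => xM.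
  by move/negP: xJ; apply; rewrite inE /J/= in_itv/= -ler_norml ltW.
have [iD _] := acf _ _ MM.
have iu : mu.-integrable setT (EFin \o (D \_ J)).
  have := (@integrable_mkcond _ _ _ mu J (EFin \o D) mJ).1 iD.
  by apply: eq_integrable => // x _ /=; rewrite !patchE; case: ifP.
have iphi' := integrable_test_fun tdphi.
have := Fubini_half_plane iu iphi'.
rewrite [X in X = _ -> _](_ : _ = - \int[mu]_x (D x * phi x)%:E)%E; last first.
  have iDphi := integrable_locally_test_fun lD tphi.
  rewrite -integralN; last first.
    by rewrite fin_num_adde_defl// fin_numN; exact: integrable_neg_fin_num.
  apply: eq_integral => x _; rewrite integral_derive1_test_fun// patchE.
  case: ifPn => [_|/outJ[-> _]]; first by rewrite -EFinM mulrN EFinN.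
  by rewrite oppr0 !mulr0 oppe0 -EFinM mulr0.
move=> ->; transitivity
    (\int[mu]_y ((f y * derive1 phi y)%:E - (f (- M))%:E * (derive1 phi y)%:E))%E.
  rewrite integralB//; [|exact: integrable_locally_test_fun|exact: integrableZl].
  by rewrite integralZl// integral_derive1_test_fun0// mule0 sube0.
apply: eq_integral => y _.
have [yJ|/outJ[_ ->]] := boolP (y \in J); last by rewrite mulr0 mule0 sube0 mul0e.
have /andP[My yM] : - M <= y <= M by move: yJ; rewrite inE /J/= in_itv.
rewrite (ac_deriv_integral_restrict acf My yM).
by rewrite -EFinM -EFinB -EFinM; congr EFin; ring.
Qed.

Lemma ac_deriv_exists D : locally_integrable setT D -> exists f, ac_deriv f D.
Proof.
move=> lD; have iD a b : mu.-integrable `[a, b] (EFin \o D).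
  exact: locally_integrable_itv.
pose J a b := fine (\int[mu]_(t in `[a, b]) (D t)%:E)%E.
have JE a b : (\int[mu]_(t in `[a, b]) (D t)%:E)%E = (J a b)%:E.
  by rewrite /J fineK//; exact: integrable_fin_num.
have Jcat a b c : a <= b -> b <= c -> J a c = J a b + J b c.
  move=> ab bc; apply: EFin_inj; rewrite EFinD -!JE (@integral_itv_cat _ _ _ _ b)//.
  exact: measurable_int (iD a c).
exists (fun y => if 0 <= y then J 0 y else - J y 0) => a b ab; split => //.
rewrite JE; congr EFin; case: (leP 0 a) => [a0|/ltW a0].
  by rewrite (le_trans a0 ab) (Jcat _ _ _ a0 ab); ring.
case: (leP 0 b) => [b0|/ltW b0]; first by rewrite (Jcat _ _ _ a0 b0); ring.
by rewrite (Jcat _ _ _ ab b0); ring.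
Qed.

Lemma ae_exists (P : R -> Prop) : {ae mu, forall x, P x} -> exists x, P x.
Proof.
move=> [A [mA A0 sA]]; apply: contrapT => nP.
have AT : `[0%R, 1%R]%classic `<=` A.
  by move=> x _; apply: sA => Px; apply: nP; exists x.
have : (mu `[0%R, 1%R] <= mu A)%E by apply: le_measure => //; rewrite inE.
by rewrite A0 lebesgue_measure_itv/= lte_fin ltr01 oppr0 adde0 lee_fin ler10.
Qed.

Lemma weak_deriv_ac psi dpsi : weak_deriv psi dpsi ->
  exists2 f, ac_deriv f dpsi & {ae mu, forall x, psi x = f x}.
Proof.
move=> wpsi; have [lpsi [ldpsi _]] := wpsi.
have [F acF] := ac_deriv_exists ldpsi; have wF := ac_deriv_weak acF.
have wdiff : weak_deriv (fun x => psi x - F x) (cst 0).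
  have := weak_derivB wpsi wF; rewrite (_ : (fun x => dpsi x - dpsi x) = cst 0)//.
  by apply/funext => x; rewrite subrr.
have Lae := lebesgue_differentiation (proj1 wdiff).
have [a La] := ae_exists Lae.
exists (fun x => F x + (psi a - F a)); first exact: ac_deriv_addr.
apply: (@filterS _ _ (ae_filter_ringOfSetsType mu) _ _ _ Lae) => x Lx.
by rewrite -(weak_deriv0_lebesgue_pt_eq wdiff Lx La) subrKC.
Qed.

End WeakAndAbsolutelyContinuous.

Section Kernel.
Context {R : realType}.
Local Notation mu := (@lebesgue_measure R).
Implicit Types (s t x y : R).

Lemma bigcup_itvcc_oc (c : nat -> R) (a b : R) :
  (forall n, a < c n) -> c n @[n --> \oo] --> a ->
  \bigcup_n `[c n, b]%classic = `]a, b]%classic.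
Proof.
move=> ac ca; apply/seteqP; split => x /=.
  by move=> [n _] /=; rewrite !in_itv/= => /andP[cx ->]; rewrite (lt_le_trans (ac n)).
rewrite in_itv/= => /andP[ax xb]; have /cvgr_lt/(_ _ ax)[n _ cx] := ca.
by exists n => //=; rewrite in_itv/= xb andbT ltW//; exact: cx (leqnn n).
Qed.

Lemma cvg_ge0_integral_itvcc_oc (f : R -> R) (c : nat -> R) (a b : R) :
  (forall n, a < c n) -> nonincreasing_seq c -> c n @[n --> \oo] --> a ->
  (forall x, a < x <= b -> 0 <= f x) ->
  (forall x, a < x <= b -> {for x, continuous f}) ->
  (\int[mu]_(x in `[c n, b]) (f x)%:E)%E @[n --> \oo] --> (\int[mu]_(x in `]a, b]) (f x)%:E)%E.
Proof.
move=> ac c_noninc ca f0 cf; have covers := bigcup_itvcc_oc b ac ca.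
have oc n x : `[c n, b]%classic x -> a < x <= b.
  by rewrite /= in_itv/= => /andP[cx ->]; rewrite (lt_le_trans (ac n)).
have mf n : measurable_fun `[c n, b] f.
  apply: subspace_continuous_measurable_fun => //.
  by apply: continuous_in_subspaceT => x; rewrite inE => /oc /cf.
rewrite -covers; apply: (@ge0_nondecreasing_set_cvg_integral _ _ R) => //.
- move=> i j ij; rewrite subsetEset; apply: subset_itvr; rewrite bnd_simp.
  exact: c_noninc.
- by move=> n; apply/measurable_EFinP; exact: mf.
- by move=> n x /oc xab; rewrite lee_fin f0.
Qed.

Lemma ge0_continuous_FTC2_oc (f F : R -> R) (a b : R) : a < b ->
  (forall x, a < x <= b -> 0 <= f x) ->
  (forall x, a < x <= b -> {for x, continuous f}) ->
  (forall x, a < x <= b -> is_derive x 1 F (f x)) -> F x @[x --> a^'+] --> F a ->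
  (\int[mu]_(x in `]a, b]) (f x)%:E = (F b - F a)%:E)%E.
Proof.
move=> ab f0 cf dF cFa; have cF x : a < x <= b -> {for x, continuous F}.
  by move=> xab; apply/differentiable_continuous/derivable1_diffP; case: (dF x xab).
have FTC c : a < c -> c < b -> (\int[mu]_(x in `[c, b]) (f x)%:E = (F b - F c)%:E)%E.
  move=> ac cb; have acb : a < c <= b by rewrite ac ltW.
  have abb : a < b <= b by rewrite ab lexx.
  have inside x : x \in `]c, b[ -> a < x <= b.
    by rewrite in_itv/= => /andP[cx xb]; rewrite (lt_trans ac cx) ltW.
  rewrite (continuous_FTC2 (F := F) cb) ?EFinB//.
  - apply/(continuous_within_itvP _ cb); split.
    + by move=> x /inside; exact: cf.
    + by apply: cvg_at_right_filter; exact: cf.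
    + by apply: cvg_at_left_filter; exact: cf.
  - split.
    + by move=> x /inside xab; case: (dF x xab).
    + by apply: cvg_at_right_filter; exact: cF.
    + by apply: cvg_at_left_filter; exact: cF.
  - by move=> x /inside xab; rewrite derive1E; case: (dF x xab).
pose c n := a + (b - a) * (n.+2%:R)^-1.
have ac n : a < c n by rewrite ltrDl mulr_gt0// subr_gt0.
have cb n : c n < b by rewrite -ltrBrDl gtr_pMr ?subr_gt0// invf_lt1// ltr1n.
have c_noninc : nonincreasing_seq c.
  move=> i j ij; rewrite lerD2l ler_wpM2l ?subr_ge0 ?(ltW ab)//.
  by rewrite lef_pV2 ?posrE// ler_nat.
have ca : c n @[n --> \oo] --> a.
  rewrite -[X in _ --> X]addr0; apply: cvgD; first exact: cvg_cst.
  rewrite -[X in _ --> X](mulr0 (b - a)); apply: cvgMl_tmp.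
  by have := @cvg_harmonic R; rewrite -(@cvg_shiftS R^o harmonic).
have cFc : F (c n) @[n --> \oo] --> F a by have /cvg_at_rightP := cFa; apply.
have := cvg_ge0_integral_itvcc_oc ac c_noninc ca f0 cf.
under eq_fun do rewrite FTC//.
move=> /cvg_lim <- //; apply/cvg_lim => //; apply: cvg_EFin; first exact: nearW.
by apply: cvgB => //; exact: cvg_cst.
Qed.

Lemma r_ker_ge0 x : 0 <= r_ker x.
Proof. by rewrite /r_ker; case: ifP => // _; rewrite divr_ge0// mulr_ge0. Qed.

Lemma r_ker_sub_eq0 t s : s <= t -> r_ker (t - s) = 0.
Proof. by move=> st; rewrite /r_ker subr_lt0 ltNge st. Qed.

Lemma r_ker_subE t s : t < s -> r_ker (t - s) = 2 * Num.sqrt 2 / (3 * Num.sqrt (s - t)).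
Proof. by move=> ts; rewrite /r_ker subr_lt0 ts opprB. Qed.

Lemma sqrt_sub_continuous t : continuous (fun x => Num.sqrt (x - t)).
Proof.
move=> x; apply: (@continuous_comp _ _ _ (fun x : R => x - t)).
  by apply: cvgB => //; exact: cvg_cst.
exact: sqrt_continuous.
Qed.

Lemma r_ker_continuous x : x < 0 -> {for x, continuous (@r_ker R)}.
Proof.
move=> x0; rewrite /prop_for /continuous_at {2}/r_ker x0.
have : (2 * Num.sqrt 2 / (3 * Num.sqrt (- y))) @[y --> x] -->
    (2 * Num.sqrt 2 / (3 * Num.sqrt (- x))).
  apply: cvgMl_tmp; apply: cvgV; first by rewrite mulf_neq0// sqrtr_eq0 -ltNge oppr_gt0.
  apply: cvgMl_tmp; apply: continuous_comp; last exact: sqrt_continuous.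
  exact: opp_continuous.
apply: cvg_trans; apply: near_eq_cvg; near=> y.
by rewrite /r_ker ifT//; near: y; exact: lt_nbhsl.
Unshelve. all: by end_near. Qed.

Lemma r_ker_sub_continuous t s : t < s -> {for s, continuous (fun x => r_ker (t - x))}.
Proof.
move=> ts; apply: continuous_comp; last by apply: r_ker_continuous; rewrite subr_lt0.
by apply: cvgB; [exact: cvg_cst|exact: cvg_id].
Qed.

Lemma measurable_r_ker_sub t : measurable_fun setT (fun s => r_ker (t - s)).
Proof.
have -> : (fun s => r_ker (t - s)) = (fun s => r_ker (t - s)) \_ `]t, +oo[.
  apply/funext => s; rewrite patchE mem_setE in_itv/= andbT.
  by case: (ltP t s) => // st; rewrite r_ker_sub_eq0.
apply/(measurable_restrictT _ _).1 => //.
apply: open_continuous_measurable_fun; first exact: interval_open.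
by move=> s; rewrite inE/= in_itv/= andbT; exact: r_ker_sub_continuous.
Qed.

Lemma is_derive_sqrt_sub t x : t < x ->
  is_derive x 1 (fun x => Num.sqrt (x - t)) ((2 * Num.sqrt (x - t))^-1).
Proof.
move=> tx; have dsub : is_derive x 1 (fun x => x - t) 1.
  by apply: is_derive_eq (is_deriveB (is_derive_id _ _) (is_derive_cst _ _ _)) _;
    rewrite subr0.
have tx0 : 0 < x - t by rewrite subr_gt0.
have := @is_derive1_comp _ _ (fun x => x - t) _ _ _ (is_derive1_sqrt tx0) dsub.
by move=> dcomp; apply: is_derive_eq dcomp _; rewrite mulr1.
Qed.

Definition r_ker_mass t (A : \bar R) : \bar R :=
  (\int[mu]_(s in [set s | (s%:E < A)%E]) (r_ker (t - s))%:E)%E.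

Lemma measurable_lt_ereal (A : \bar R) : measurable [set s : R | (s%:E < A)%E].
Proof.
have mEFin : measurable_fun setT (@EFin R) by apply/measurable_EFinP; exact: measurable_id.
by have := emeasurable_fun_infty_o measurableT mEFin A; rewrite setTI.
Qed.

Lemma r_ker_mass_ge0 t A : (0 <= r_ker_mass t A)%E.
Proof. by apply: integral_ge0 => s _; rewrite lee_fin r_ker_ge0. Qed.

Lemma le_r_ker_mass t A B : (A <= B)%E -> (r_ker_mass t A <= r_ker_mass t B)%E.
Proof.
move=> AB; apply: ge0_le_integral_subset => [s /= /lt_le_trans|s _|s _|//]; first exact.
- by rewrite lee_fin r_ker_ge0.
- by rewrite lee_fin r_ker_ge0.
Qed.

Lemma r_ker_massE t (A : R) :
  r_ker_mass t A%:E = (4 / 3 * Num.sqrt 2 * Num.sqrt (A - t))%:E.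
Proof.
have -> : r_ker_mass t A%:E = (\int[mu]_(s in `]t, A]) (r_ker (t - s))%:E)%E.
  rewrite /r_ker_mass (_ : [set s | (s%:E < A%:E)%E] = `]-oo, A[%classic); last first.
    by apply/seteqP; split => s /=; rewrite in_itv/= lte_fin.
  rewrite integral_itv_bndo_bndc; last first.
    by apply/measurable_EFinP; exact: measurable_funS (measurable_r_ker_sub t).
  rewrite integral_mkcond [RHS]integral_mkcond; apply: eq_integral => s _.
  rewrite !patchE !mem_setE !in_itv/=; case: (ltP t s) => //= st.
  by rewrite r_ker_sub_eq0//; case: ifP.
have [At|tA] := leP A t.
  rewrite set_itv_ge; last by rewrite bnd_simp -leNgt.
  by rewrite integral_set0 (@ler0_sqrtr _ (A - t)) ?mulr0// subr_le0.
pose F (s : R) : R := 4 / 3 * Num.sqrt 2 * Num.sqrt (s - t).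
have Ft : F t = 0 by rewrite /F subrr sqrtr0 mulr0.
rewrite (_ : 4 / 3 * _ * _ = F A - F t); last by rewrite Ft subr0.
apply: (@ge0_continuous_FTC2_oc (fun s => r_ker (t - s)) F _ _ tA).
- by move=> s _; exact: r_ker_ge0.
- by move=> s /andP[ts _]; exact: r_ker_sub_continuous.
- move=> s /andP[ts _]; rewrite (r_ker_subE ts).
  apply: is_derive_eq (is_deriveZ _ (is_derive_sqrt_sub ts)) _.
  by rewrite /GRing.scale/=; field; rewrite sqrtr_eq0 -ltNge subr_gt0.
- by apply: cvg_at_right_filter; apply: cvgMl_tmp; exact: sqrt_sub_continuous.
Qed.

End Kernel.

Section LayerCake.
Context {R : realType}.
Local Notation mu := (@lebesgue_measure R).

Lemma nonincreasing_emeasurable (D : set R) (f : R -> \bar R) : is_interval D ->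
  {in D &, {homo f : x y / x <= y >-> (y <= x)%E}} -> measurable_fun D f.
Proof.
move=> iD fni; apply: (measurability _ (ErealGenOInfty.measurableE R)).
move=> _ [_ [r ->] <-]; apply: is_interval_measurable => x y /= [Dx fx] [Dy fy] t xty.
have Dt := iD _ _ Dx Dy t xty; split => //; move: fx fy; rewrite !in_itv/= !andbT.
by move=> _ /lt_le_trans; apply; apply: fni; rewrite ?inE//; case/andP: xty.
Qed.

Lemma layer_cake (D : set R) (a phi k : R -> \bar R) : measurable D ->
  measurable_fun D a -> measurable_fun D phi -> measurable_fun setT k ->
  (forall x, D x -> 0 <= a x)%E -> (forall s, 0 <= k s)%E ->
  (\int[mu]_(x in D) (a x * \int[mu]_(s in [set s | s%:E < phi x]) k s) =
   \int[mu]_s (k s * \int[mu]_(x in D `&` [set x | s%:E < phi x]) a x))%E.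
Proof.
move=> mD ma mphi mk a0 k0.
have ma' : measurable_fun setT (a \_ D) by exact/(measurable_restrictT _ _).1.
have mphi' : measurable_fun setT (phi \_ D) by exact/(measurable_restrictT _ _).1.
have a'0 x : (0 <= (a \_ D) x)%E by exact: erestrict_ge0.
pose F (p : measurableTypeR R * measurableTypeR R) : \bar R :=
  (if p.2%:E < (phi \_ D) p.1 then (a \_ D) p.1 * k p.2 else 0)%E.
have F0 p : (0 <= F p)%E by rewrite /F; case: ifP => // _; rewrite mule_ge0.
have mF : measurable_fun setT F.
  apply: measurable_fun_ifT => //=.
    apply: measurable_fun_lte; last exact: measurableT_comp mphi' measurable_fst.
    by apply/measurable_EFinP; exact: measurable_snd.
  apply: emeasurable_funM; first exact: measurableT_comp ma' measurable_fst.
  exact: measurableT_comp mk measurable_snd.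
transitivity (\int[mu]_x \int[mu]_s F (x, s))%E.
  rewrite integral_mkcond; apply: eq_integral => x _; rewrite patchE.
  case: ifPn => xD; last first.
    rewrite integral0_eq// => s _.
    by rewrite /F/= !patchE (negbTE xD) mul0e; case: ifP.
  have Dx : D x by move: xD; rewrite inE.
  rewrite -ge0_integralZl ?a0//; last 2 first.
  - exact: measurable_lt_ereal.
  - exact: measurable_funS mk.
  rewrite integral_mkcond; apply: eq_integral => s _.
  by rewrite /F/= !patchE xD mem_setE.
rewrite (fubini_tonelli F)//; apply: eq_integral => s _.
have mDs : measurable (D `&` [set x | (s%:E < phi x)%E]) by exact: emeasurable_fun_o_infty.
rewrite -ge0_integralZl ?k0//; last 2 first.
- by apply: measurable_funS ma => //; exact: subIsetl.
- by move=> x [Dx _]; exact: a0.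
rewrite [RHS]integral_mkcond; apply: eq_integral => x _.
rewrite /F/= !patchE in_setI; case: (x \in D) => /=; last by rewrite mul0e; case: ifP.
rewrite mem_setE [x \in _](_ : _ = (s%:E < phi x)%E)//.
by case: ifP => // _; rewrite muleC.
Qed.

End LayerCake.

Section BandVariation.
Context {R : realType}.
Local Notation mu := (@lebesgue_measure R).
Implicit Types (f D : R -> R) (p q lo hi m : R).

Lemma crossing_itv f p q lo hi : continuous f -> p <= q ->
  hi <= f p -> f q <= lo -> exists u v, [/\ p <= u, u <= v, v <= q,
    hi <= f u /\ f v <= lo & forall x, u < x < v -> lo < f x < hi].
Proof.
move=> cf pq hip qlo.
have clopre (A : set R) : closed A -> closed (f @^-1` A).
  by apply: closed_comp => x _; exact: cf.
have extremal a b (A : set R) : closed A -> (exists2 x, a <= x <= b & A x) ->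
    compact (`[a, b] `&` A) /\ (`[a, b] `&` A) !=set0.
  move=> clA [x xab Ax]; split; last by exists x; split => //=; rewrite in_itv.
  by apply: compact_closedI => //; exact: segment_compact.
have idc (A : set R) : {within A, continuous (@idfun R)}.
  by apply: continuous_subspaceT => x; exact: cvg_id.
have [] := extremal p q (f @^-1` [set y | hi <= y]).
- by apply: clopre; exact: closed_ge.
- by exists p => //; rewrite lexx.
move=> cA A0; have [u] := compact_EVT_max A0 cA (idc _).
rewrite inE => -[/= + hiu] umax; rewrite in_itv/= => /andP[pu uq].
have [] := extremal u q (f @^-1` [set y | y <= lo]).
- by apply: clopre; exact: closed_le.
- by exists q => //; rewrite uq lexx.
move=> cB B0; have [v] := compact_EVT_min B0 cB (idc _).
rewrite inE => -[/= + vlo] vmin; rewrite in_itv/= => /andP[uv vq].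
exists u, v; split => // x /andP[ux xv]; apply/andP; split; rewrite ltNge; apply/negP => fx.
- have : v <= x; last by rewrite leNgt xv.
  apply: vmin; rewrite inE; split => //=.
  by rewrite in_itv/= (ltW ux) (le_trans (ltW xv)).
- have : x <= u; last by rewrite leNgt ux.
  apply: umax; rewrite inE; split => //=.
  by rewrite in_itv/= (le_trans pu (ltW ux)) (le_trans (ltW xv)).
Qed.

Definition band_speed f D lo hi : R -> \bar R :=
  (fun x => `|D x|%:E) \_ (f @^-1` `]lo, hi[).

Lemma measurable_band f lo hi : measurable_fun setT f ->
  measurable (f @^-1` `]lo, hi[).
Proof. by move=> mf; rewrite -[X in measurable X]setTI; exact: mf. Qed.

Lemma measurable_band_speed f D lo hi : ac_deriv f D ->
  measurable_fun setT (band_speed f D lo hi).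
Proof.
move=> acf; apply/(measurable_restrictT _ _).1.
  exact: measurable_band (ac_deriv_measurable_fun acf).
apply: measurable_funTS; apply/measurable_EFinP; apply: measurableT_comp => //.
exact: ac_deriv_measurable acf.
Qed.

Lemma band_speed_ge0 f D lo hi x : (0 <= band_speed f D lo hi x)%E.
Proof. exact: erestrict_ge0. Qed.

Lemma band_variation_itv_ge f D p q lo hi : ac_deriv f D -> p <= q ->
  hi <= f p -> f q <= lo ->
  ((hi - lo)%:E <= \int[mu]_(x in `[p, q]) band_speed f D lo hi x)%E.
Proof.
move=> acf pq hip qlo; have mD := ac_deriv_measurable acf.
have [u [v [pu uv vq [hiu vlo] inside]]] :=
  crossing_itv (ac_deriv_continuous acf) pq hip qlo.
apply: (@le_trans _ _ (\int[mu]_(x in `]u, v[) band_speed f D lo hi x)%E); last first.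
  apply: ge0_le_integral_subset => [|x _|x _|//]; rewrite ?band_speed_ge0//.
  by apply: subset_itv; rewrite bnd_simp.
have -> : (\int[mu]_(x in `]u, v[) band_speed f D lo hi x =
    \int[mu]_(x in `]u, v[) `|(D x)%:E|)%E.
  apply: eq_integral => x; rewrite inE/= in_itv/= /band_speed patchE => /inside xin.
  by rewrite mem_set//= in_itv.
have mDuv : measurable_fun `]u, v[ (EFin \o D).
  by apply/measurable_EFinP; exact: measurable_funS mD.
apply: (@le_trans _ _ `|\int[mu]_(x in `]u, v[) (D x)%:E|%E); last exact: le_abse_integral.
have [_] := acf _ _ uv; rewrite integral_itv_bndoo// => <-.
by rewrite lee_fin -normrN opprB (le_trans _ (ler_norm _))//; lra.
Qed.

Definition band_variation f D lo hi : \bar R :=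
  (\int[mu]_(x in f @^-1` `]lo, hi[) `|D x|%:E)%E.

Lemma band_variation_ge0 f D lo hi : (0 <= band_variation f D lo hi)%E.
Proof. exact: integral_ge0. Qed.

Lemma band_variation_ge f D (q1 p q2 lo hi : R) : ac_deriv f D -> q1 <= p -> p <= q2 ->
  hi <= f p -> f q1 <= lo -> f q2 <= lo ->
  ((2 * (hi - lo))%:E <= band_variation f D lo hi)%E.
Proof.
move=> acf q1p pq2 hip q1lo q2lo; have mspeed := measurable_band_speed lo hi acf.
rewrite /band_variation integral_mkcond -/(band_speed f D lo hi) -set_itvNyy.
rewrite (@integral_itv_cat _ _ _ _ p)//; last by rewrite set_itvNyy.
rewrite mulr_natl mulr2n EFinD; apply: leeD.
- have : ((- lo - - hi)%:E <= \int[mu]_(x in `[q1, p])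
      band_speed (fun x => - f x)%R (fun x => - D x)%R (- hi) (- lo) x)%E.
    by apply: band_variation_itv_ge; rewrite ?lerN2//; exact: ac_derivN.
  rewrite opprK addrC => /le_trans; apply.
  have -> : band_speed (fun x => - f x) (fun x => - D x) (- hi) (- lo) =
      band_speed f D lo hi.
    apply/funext => x; rewrite /band_speed !patchE normrN.
    rewrite (_ : (x \in _) = (x \in f @^-1` `]lo, hi[%classic))//.
    by apply/idP/idP; rewrite !inE/= !in_itv/= !ltrN2 andbC.
  apply: ge0_le_integral_subset => [|x _|x _|//]; rewrite ?band_speed_ge0//.
  by apply: subset_itv; rewrite bnd_simp.
- apply: (le_trans (band_variation_itv_ge acf pq2 hip q2lo)).
  apply: ge0_le_integral_subset => [|x _|x _|//]; rewrite ?band_speed_ge0//.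
  by apply: subset_itv; rewrite bnd_simp.
Qed.

Lemma integral_sub_div_sqrt m : 0 < m ->
  (\int[mu]_(s in `]0%R, m]) (3 / 4 * (m - s) / Num.sqrt s)%:E
    = (m * Num.sqrt m)%:E)%E.
Proof.
move=> m0; pose F (s : R) : R := (3 / 2 * m - s / 2) * Num.sqrt s.
have Fm : F m - F 0 = m * Num.sqrt m by rewrite /F sqrtr0 mulr0 subr0; field.
rewrite -Fm.
apply: (@ge0_continuous_FTC2_oc _ (fun s => 3 / 4 * (m - s) / Num.sqrt s) F _ _ m0).
- by move=> s /andP[_ sm]; rewrite divr_ge0 ?sqrtr_ge0// mulr_ge0 ?subr_ge0.
- move=> s /andP[s0 _]; apply: cvgM.
    by apply: cvgMl_tmp; apply: cvgB => //; exact: cvg_cst.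
  by apply: cvgV; [rewrite sqrtr_eq0 -ltNge|exact: sqrt_continuous].
- move=> s /andP[s0 _].
  have dlin : is_derive s 1 (fun s : R => 3 / 2 * m - s / 2) (- 2^-1).
    have := is_deriveB (is_derive_cst (3 / 2 * m) s (1 : R))
      (is_deriveZ 2^-1 (is_derive_id s (1 : R))).
    rewrite (_ : _ - _ = fun s : R => 3 / 2 * m - s / 2); last first.
      by apply/funext => x; rewrite /= /GRing.scale/= [x * _]mulrC.
    by move=> dlin; apply: is_derive_eq dlin _; rewrite /GRing.scale/=; field.
  apply: is_derive_eq (is_deriveM dlin (is_derive1_sqrt s0)) _.
  rewrite /GRing.scale/=; have := sqr_sqrtr (ltW s0).
  have : Num.sqrt s != 0 by rewrite sqrtr_eq0 -ltNge.
  by set r := Num.sqrt s => r0 <-; field.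
- apply: cvg_at_right_filter; apply: cvgM; last exact: sqrt_continuous.
  by apply: cvgB; [exact: cvg_cst|exact: cvgMr_tmp].
Qed.

End BandVariation.

Section Pow32Variation.
Context {R : realType}.
Local Notation mu := (@lebesgue_measure R).
Implicit Types (f D : R -> R).

Lemma ge0_integral_small_value f (w a b r : R) : (forall x, 0 <= f x) ->
  (\int[mu]_x (f x)%:E = w%:E)%E -> a <= b ->
  w < r * (b - a) -> exists2 x, a <= x <= b & f x <= r.
Proof.
move=> f0 fw ab wr; apply: contrapT => big.
have rf x : a <= x <= b -> r <= f x.
  by move=> xab; rewrite leNgt; apply/negP => fx; apply: big; exists x => //; exact: ltW.
have : ((r * (b - a))%:E <= w%:E)%E; last by rewrite lee_fin leNgt wr.
rewrite -fw -integral_cst_itv//.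
have w0 : 0 <= w by rewrite -lee_fin -fw; apply: integral_ge0 => y _; rewrite lee_fin.
have r0 : 0 <= r.
  rewrite leNgt; apply/negP => r0; move: wr; rewrite ltNge (le_trans _ w0)//.
  by rewrite mulr_le0_ge0 ?subr_ge0// ltW.
by apply: ge0_le_integral_subset => // x; rewrite ?lee_fin//= in_itv => /rf.
Qed.

Lemma ge0_integral_small_values f (w p r : R) : (forall x, 0 <= f x) ->
  (\int[mu]_x (f x)%:E = w%:E)%E -> 0 < r ->
  (exists2 q, q <= p & f q <= r) /\ (exists2 q, p <= q & f q <= r).
Proof.
move=> f0 fw r0.
have w0 : 0 <= w by rewrite -lee_fin -fw; apply: integral_ge0 => y _; rewrite lee_fin.
pose L := (w + 1) / r; have L0 : 0 <= L by rewrite divr_ge0 ?addr_ge0 ?(ltW r0).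
have rL : w < r * L by rewrite mulrC divfK ?gt_eqF// ltrDl.
split.
- have [||q /andP[_ qp] fq] := @ge0_integral_small_value f w (p - L) p r f0 fw.
  + by rewrite gerBl.
  + by rewrite subKr.
  + by exists q.
- have [||q /andP[pq _] fq] := @ge0_integral_small_value f w p (p + L) r f0 fw.
  + by rewrite lerDl.
  + by rewrite addrAC subrr add0r.
  + by exists q.
Qed.

Definition half_pow32_speed f D x : R := 3 / 4 * (Num.sqrt (f x) * `|D x|).

Lemma half_pow32_speed_ge0 f D x : 0 <= half_pow32_speed f D x.
Proof. by rewrite !mulr_ge0 ?sqrtr_ge0. Qed.

Lemma measurable_half_pow32_speed f D : ac_deriv f D ->
  measurable_fun setT (EFin \o half_pow32_speed f D).
Proof.
move=> acf; apply/measurable_EFinP; apply: measurable_funM => //.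
apply: measurable_funM.
  apply: (measurableT_comp _ (ac_deriv_measurable_fun acf)).
  by apply: continuous_measurable_fun; exact: sqrt_continuous.
by apply: measurableT_comp => //; exact: ac_deriv_measurable acf.
Qed.

(* [3 / (8 * sqrt s)] for [s > 0], as a multiple of the kernel so that [r_ker_massE]
   gives its primitive. *)
Definition sqrt_ker (s : R) : R := 9 / (16 * Num.sqrt 2) * r_ker (0 - s).

Lemma sqrt_ker_ge0 s : 0 <= sqrt_ker s.
Proof. by rewrite mulr_ge0 ?r_ker_ge0// divr_ge0// mulr_ge0 ?sqrtr_ge0. Qed.

Lemma measurable_sqrt_ker : measurable_fun setT sqrt_ker.
Proof. by apply: measurable_funM => //; exact: measurable_r_ker_sub. Qed.

Lemma sqrt_kerE s : 0 < s -> sqrt_ker s = 3 / (8 * Num.sqrt s).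
Proof.
move=> s0; rewrite /sqrt_ker r_ker_subE// subr0.
by field; rewrite !sqrtr_eq0 -!ltNge s0/=.
Qed.

Lemma integral_sqrt_ker (x : R) :
  (\int[mu]_(s in [set s | s%:E < x%:E]) (sqrt_ker s)%:E)%E = (3 / 4 * Num.sqrt x)%:E.
Proof.
under eq_integral do rewrite EFinM.
rewrite ge0_integralZl_EFin//; last 3 first.
- exact: measurable_lt_ereal.
- by move=> s _; rewrite lee_fin r_ker_ge0.
- by apply/measurable_EFinP; exact: measurable_funS (measurable_r_ker_sub 0).
rewrite -/(r_ker_mass 0 x%:E) r_ker_massE subr0 -EFinM; congr EFin.
by field; rewrite sqrtr_eq0 -ltNge.
Qed.

Lemma integral_half_pow32_speed f D m : ac_deriv f D ->
  (\int[mu]_(x in f @^-1` `]-oo, m[) (half_pow32_speed f D x)%:E =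
   \int[mu]_s ((sqrt_ker s)%:E * band_variation f D s m))%E.
Proof.
move=> acf; have mf := ac_deriv_measurable_fun acf.
pose sub := f @^-1` `]-oo, m[%classic.
have msub : measurable sub by rewrite -[X in measurable X]setTI; exact: mf.
transitivity (\int[mu]_(x in sub) (`|D x|%:E *
    \int[mu]_(s in [set s | s%:E < (f x)%:E]) (sqrt_ker s)%:E))%E.
  apply: eq_integral => x _; rewrite integral_sqrt_ker -EFinM; congr EFin.
  by rewrite /half_pow32_speed; ring.
rewrite (@layer_cake _ sub _ (EFin \o f) (EFin \o sqrt_ker)); first last.
- by move=> s; rewrite lee_fin sqrt_ker_ge0.
- by [].
- by apply/measurable_EFinP; exact: measurable_sqrt_ker.
- by apply/measurable_EFinP; exact: measurable_funS mf.
- apply: measurable_funTS; apply/measurable_EFinP; apply: measurableT_comp => //.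
  exact: ac_deriv_measurable acf.
- exact: msub.
apply: eq_integral => s _; congr (_ * integral _ _ _)%E.
by apply/seteqP; split => x /=; rewrite /sub/= !in_itv/= lte_fin;
  [move=> [-> ->]|move=> /andP[-> ->]].
Qed.

Lemma half_pow32_variation_ge f D (w p m : R) : ac_deriv f D -> (forall x, 0 <= f x) ->
  (\int[mu]_x (f x)%:E = w%:E)%E -> 0 <= m -> m <= f p ->
  ((m * Num.sqrt m)%:E <=
    \int[mu]_(x in f @^-1` `]-oo, m[) (half_pow32_speed f D x)%:E)%E.
Proof.
move=> acf f0 fw; rewrite le_eqVlt => /predU1P[<- _|m0 mp].
  by rewrite mul0r; apply: integral_ge0 => x _; rewrite lee_fin half_pow32_speed_ge0.
rewrite (integral_half_pow32_speed _ acf) -integral_sub_div_sqrt//.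
apply: ge0_le_integral_subset => // s; rewrite /= ?in_itv/=.
- by move=> /andP[_ sm]; rewrite lee_fin divr_ge0 ?sqrtr_ge0// mulr_ge0 ?subr_ge0.
- by move=> _; rewrite mule_ge0 ?band_variation_ge0// lee_fin sqrt_ker_ge0.
move=> /andP[s0 sm].
have -> : (3 / 4 * (m - s) / Num.sqrt s)%:E = ((sqrt_ker s)%:E * (2 * (m - s))%:E)%E.
  rewrite sqrt_kerE// -EFinM; congr EFin.
  by field; rewrite sqrtr_eq0 -ltNge.
rewrite lee_wpmul2l ?lee_fin ?sqrt_ker_ge0//.
have [[q1 q1p fq1] [q2 pq2 fq2]] := ge0_integral_small_values p f0 fw s0.
exact: band_variation_ge acf q1p pq2 mp fq1 fq2.
Qed.

End Pow32Variation.

Section EnergyDensity.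
Context {R : realType}.
Local Notation mu := (@lebesgue_measure R).
Variable z : R -> \bar R.
Hypothesis z_ge0 : forall x : R, 0 <= x -> (0 <= z x)%E.
Hypothesis z_noninc : nonincreasing0 z.
Local Notation G := (convol (g_of z) (@r_ker R)).
Implicit Types (f D : R -> R) (s t x y m : R).

Lemma c_ofE x : c_of z x = (z x * x%:E)%E.
Proof. by rewrite /c_of; case: eqP => // ->; rewrite mule0. Qed.

Lemma c_of_ge0 x : 0 <= x -> (0 <= c_of z x)%E.
Proof. by move=> x0; rewrite c_ofE mule_ge0// ?z_ge0// lee_fin. Qed.

Lemma measurable_noninc0 : measurable_fun (`[0, +oo[%classic : set R) z.
Proof.
apply: nonincreasing_emeasurable => [|x y]; first exact: interval_is_interval.
by rewrite !inE/= !in_itv/= !andbT => x0 _; exact: z_noninc.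
Qed.

Lemma measurable_noninc0_comp f : measurable_fun setT f -> (forall x, 0 <= f x) ->
  measurable_fun setT (fun x => z (f x)).
Proof.
move=> mf f0; apply: measurable_comp measurable_noninc0 mf => //.
by move=> _ [x _ <-]; rewrite /= in_itv/= andbT.
Qed.

Definition energy_density f D x : \bar R :=
  ((2^-1 * D x ^+ 2)%:E + c_of z `|f x|)%E.

Lemma energy_density_ge0 f D x : (0 <= energy_density f D x)%E.
Proof. by rewrite adde_ge0 ?c_of_ge0// lee_fin mulr_ge0// sqr_ge0. Qed.

Lemma energy_densityE f D x : 0 <= f x ->
  energy_density f D x = ((2^-1 * D x ^+ 2)%:E + z (f x) * (f x)%:E)%E.
Proof. by move=> f0; rewrite /energy_density c_ofE ger0_norm. Qed.

Lemma energy_density00 f D x : f x = 0 -> D x = 0 -> energy_density f D x = 0%E.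
Proof. by move=> f0 D0; rewrite energy_densityE f0// D0 expr0n/= mulr0 mule0 adde0. Qed.

Lemma measurable_kinetic D : measurable_fun setT D ->
  measurable_fun setT (fun x => (2^-1 * D x ^+ 2)%:E).
Proof.
by move=> mD; apply/measurable_EFinP; apply: measurable_funM => //; exact: measurable_funX.
Qed.

Lemma measurable_energy_density f D : measurable_fun setT f -> measurable_fun setT D ->
  measurable_fun setT (energy_density f D).
Proof.
move=> mf mD; apply: emeasurable_funD; first exact: measurable_kinetic.
have mabs : measurable_fun setT (fun x => `|f x|) by exact: measurableT_comp.
under eq_fun do rewrite c_ofE.
by apply: emeasurable_funM; [exact: measurable_noninc0_comp|exact/measurable_EFinP].
Qed.

Lemma gen_inv_ge0 s : (0 <= gen_inv z s)%E.
Proof. by apply: le_ereal_inf_tmp => _ [y [y0 _] <-]; rewrite lee_fin. Qed.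

Lemma gen_inv_ge s y : (s%:E < z y)%E -> (y%:E <= gen_inv z s)%E.
Proof.
move=> sz; apply: le_ereal_inf_tmp => _ [x [x0 zx] <-]; rewrite lee_fin leNgt.
apply/negP => xy; have := z_noninc x0 (ltW xy).
by rewrite leNgt (le_lt_trans zx sz).
Qed.

Lemma gen_inv_le s y : 0 <= y -> (z y <= s%:E)%E -> (gen_inv z s <= y%:E)%E.
Proof. by move=> y0 zs; apply: ereal_inf_lbound; exists y. Qed.

Lemma poweR32 x : 0 <= x -> (x%:E `^ (3 / 2) = (x * Num.sqrt x)%:E)%E.
Proof.
rewrite le_eqVlt => /predU1P[<-|x0]; rewrite poweR_EFin; congr EFin.
  by rewrite mul0r powR0// mulf_neq0// invr_eq0.
have -> : 3 / 2 = 1 + 2^-1 :> R by field.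
by rewrite powRD ?(gt_eqF x0) ?implybT// powRr1 ?powR12_sqrt ?ltW.
Qed.

Lemma g_of_fin s m : gen_inv z s = m%:E -> g_of z s = (m * Num.sqrt m)%:E.
Proof.
by move=> zs; rewrite /g_of zs poweR32// -lee_fin -zs gen_inv_ge0.
Qed.

Lemma g_of_ge0 s : (0 <= g_of z s)%E. Proof. exact: poweR_ge0. Qed.

Lemma measurable_g_of : measurable_fun setT (g_of z).
Proof.
have mg : measurable_fun setT (gen_inv z).
  apply: nonincreasing_emeasurable => // x y _ _ xy; apply: ereal_inf_le_tmp.
  move=> _ [u [u0 zu] <-]; exists u => //; split => //.
  by apply: le_trans zu _; rewrite lee_fin.
exact: (measurableT_comp (measurable_poweR _) mg).
Qed.

Lemma convol_ge0 t : (0 <= G t)%E.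
Proof.
by apply: integral_ge0 => s _; rewrite mule_ge0 ?g_of_ge0// lee_fin r_ker_ge0.
Qed.

End EnergyDensity.

Section LowerBound.
Context {R : realType}.
Local Notation mu := (@lebesgue_measure R).
Variable z : R -> \bar R.
Hypothesis z_ge0 : forall x : R, 0 <= x -> (0 <= z x)%E.
Hypothesis z_noninc : nonincreasing0 z.
Local Notation G := (convol (g_of z) (@r_ker R)).
Implicit Types (f D : R -> R) (s w : R).

Lemma young_r_ker_mass s (A : \bar R) (d h : R) : 0 <= h -> (s%:E <= A)%E ->
  ((3 / 4 * (Num.sqrt h * `|d|))%:E * r_ker_mass s A <=
   (2^-1 * d ^+ 2)%:E + (A - s%:E) * h%:E)%E.
Proof.
move=> h0; case: A => [a| |]//.
- rewrite lee_fin => sa; rewrite r_ker_massE -EFinB -!EFinM -EFinD lee_fin.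
  have := sqr_ge0 (Num.sqrt 2 * Num.sqrt (a - s) * Num.sqrt h - `|d|).
  rewrite sqrrB !exprMn !sqr_sqrtr ?subr_ge0// real_normK ?num_real//; lra.
- move=> _; move: h0; rewrite le_eqVlt => /predU1P[<-|h0].
    by rewrite sqrtr0 mul0r mulr0 mul0e mule0 adde0 lee_fin mulr_ge0 ?sqr_ge0.
  by rewrite addye// gt0_mulye ?lte_fin// addey// leey.
Qed.

Definition excess_density s f D x : \bar R :=
  ((2^-1 * D x ^+ 2)%:E + (z (f x) - s%:E) * (f x)%:E)%E.

Lemma excess_density_ge0 s f D x : 0 <= f x -> (s%:E <= z (f x))%E ->
  (0 <= excess_density s f D x)%E.
Proof.
move=> f0 sz; apply: adde_ge0; first by rewrite lee_fin mulr_ge0// sqr_ge0.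
by apply: mule_ge0; rewrite ?sube_ge0 ?lee_fin.
Qed.

Lemma measurable_excess_density s f D : measurable_fun setT f ->
  measurable_fun setT D -> (forall x, 0 <= f x) ->
  measurable_fun setT (excess_density s f D).
Proof.
move=> mf mD f0; apply: emeasurable_funD; first exact: measurable_kinetic.
apply: emeasurable_funM; last exact/measurable_EFinP.
by apply: emeasurable_funB => //; exact: measurable_noninc0_comp.
Qed.

Lemma integral_energy_density s f D w : measurable_fun setT f ->
  measurable_fun setT D -> (forall x, 0 <= f x) -> 0 <= s ->
  (forall x, s%:E <= z (f x))%E -> (\int[mu]_x (f x)%:E = w%:E)%E ->
  (\int[mu]_x energy_density z f D x = \int[mu]_x excess_density s f D x + (s * w)%:E)%E.
Proof.
move=> mf mD f0 s0 sz fw.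
have mfE : measurable_fun setT (fun x => (f x)%:E) by exact/measurable_EFinP.
rewrite EFinM -fw -ge0_integralZl_EFin//; last by move=> x _; rewrite lee_fin.
rewrite -ge0_integralD//.
- apply: eq_integral => x _; rewrite energy_densityE// /excess_density -addeA; congr (_ + _)%E.
  have := sz x; have := z_ge0 (f0 x); case: (z (f x)) => [r| |]//= _ _.
    by rewrite -EFinB -!EFinM -EFinD mulrBl subrK.
  have := f0 x; rewrite le_eqVlt => /predU1P[<-|fx]; first by rewrite !mule0 adde0.
  by rewrite addye// !gt0_mulye ?lte_fin// addye.
- by move=> x _; exact: excess_density_ge0.
- exact: measurable_excess_density.
- by move=> x _; rewrite mule_ge0// lee_fin.
- exact: measurable_funeM.
Qed.

(* The sublevel set [f < gen_inv z s] lies in the layer [s < z \o f]. *)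
Lemma g_of_le_layer f D w s : ac_deriv f D -> (forall x, 0 <= f x) ->
  (\int[mu]_x (f x)%:E = w%:E)%E -> (exists x, z (f x) <= s%:E)%E ->
  (g_of z s <=
    \int[mu]_(x in [set x | s%:E < z (f x)]) (half_pow32_speed f D x)%:E)%E.
Proof.
move=> acf f0 fw [p zp]; have inv_le := gen_inv_le (f0 p) zp.
have inv_fin : gen_inv z s \is a fin_num.
  by rewrite ge0_fin_numE ?gen_inv_ge0// (le_lt_trans inv_le) ?ltry.
pose m := fine (gen_inv z s); have mE : gen_inv z s = m%:E by rewrite fineK.
have m0 : 0 <= m by rewrite fine_ge0 ?gen_inv_ge0.
have mp : m <= f p by rewrite -lee_fin -mE.
rewrite (g_of_fin mE); apply: (le_trans (half_pow32_variation_ge acf f0 fw m0 mp)).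
apply: ge0_le_integral_subset => [x|x _|x _|//]; rewrite ?lee_fin ?half_pow32_speed_ge0//.
rewrite /= in_itv/= => fx; rewrite ltNge; apply/negP => zs.
by have := gen_inv_le (f0 x) zs; rewrite mE lee_fin leNgt fx.
Qed.

Lemma convol_le_excess f D w s : ac_deriv f D -> (forall x, 0 <= f x) ->
  (\int[mu]_x (f x)%:E = w%:E)%E -> (forall x, s%:E <= z (f x))%E ->
  (forall s', s < s' -> exists x, (z (f x) <= s'%:E)%E) ->
  (G s <= \int[mu]_x excess_density s f D x)%E.
Proof.
move=> acf f0 fw sz zs; have mf := ac_deriv_measurable_fun acf.
have mzf := measurable_noninc0_comp z_noninc mf f0.
have mspeed := measurable_half_pow32_speed acf.
have mker : measurable_fun setT (fun s' => (r_ker (s - s'))%:E).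
  by apply/measurable_EFinP; exact: measurable_r_ker_sub.
have ker0 s' : (0 <= (r_ker (s - s'))%:E)%E by rewrite lee_fin r_ker_ge0.
apply: (@le_trans _ _
    (\int[mu]_x ((half_pow32_speed f D x)%:E * r_ker_mass s (z (f x))))%E); last first.
  apply: ge0_le_integral_subset => // x _; last exact: young_r_ker_mass.
  - by rewrite mule_ge0 ?r_ker_mass_ge0 ?lee_fin ?half_pow32_speed_ge0.
  - exact: excess_density_ge0.
rewrite (layer_cake measurableT mspeed mzf mker)//; last first.
  by move=> x _; rewrite lee_fin half_pow32_speed_ge0.
apply: ge0_le_integral_subset => // s' _.
- by rewrite mule_ge0 ?g_of_ge0.
- by rewrite mule_ge0// integral_ge0// => x _; rewrite lee_fin half_pow32_speed_ge0.
rewrite muleC; have [ss'|s's] := ltP s s'; last by rewrite r_ker_sub_eq0// !mul0e.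
by rewrite lee_wpmul2l// setTI; exact: g_of_le_layer acf f0 fw (zs _ ss').
Qed.

Lemma energy_lower_bound f D w : ac_deriv f D -> (forall x, 0 <= f x) -> 0 < w ->
  (\int[mu]_x (f x)%:E = w%:E)%E -> (\int[mu]_x energy_density z f D x < +oo)%E ->
  exists2 s, 0 <= s & (G s + (s * w)%:E <= \int[mu]_x energy_density z f D x)%E.
Proof.
move=> acf f0 w0 fw Eoo.
have mf := ac_deriv_measurable_fun acf; have mD := ac_deriv_measurable acf.
pose zmin := ereal_inf (range (fun x => z (f x))).
have zmin_le x : (zmin <= z (f x))%E by apply: ereal_inf_lbound; exists x.
have zmin0 : (0 <= zmin)%E by apply: le_ereal_inf_tmp => _ [x _ <-]; exact: z_ge0.
have zmin_fin : zmin \is a fin_num.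
  rewrite ge0_fin_numE// lt_neqAle leey andbT; apply/eqP => zminE.
  move: Eoo; rewrite ltNge => /negP; apply.
  rewrite (_ : +oo = \int[mu]_x (zmin * (f x)%:E))%E.
    apply: ge0_le_integral_subset => // x _; first by rewrite mule_ge0 ?lee_fin.
      exact: energy_density_ge0.
    rewrite energy_densityE//; apply: lee_paddl; last by rewrite lee_wpmul2r ?lee_fin.
    by rewrite lee_fin mulr_ge0// sqr_ge0.
  have mfE : measurable_fun setT (EFin \o f) by exact/measurable_EFinP.
  rewrite ge0_integralZl//; last by move=> x _; rewrite lee_fin.
  by rewrite fw zminE gt0_mulye ?lte_fin.
pose s := fine zmin; have sE : s%:E = zmin by rewrite fineK.
exists s; first by rewrite fine_ge0.
have sz x : (s%:E <= z (f x))%E by rewrite sE.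
rewrite (integral_energy_density mf mD f0 _ sz fw) ?fine_ge0// leeD2r//.
apply: convol_le_excess fw sz _ => // s' ss'.
have [|_ [x _ <-] zs'] := @ereal_inf_lt _ (range (fun x => z (f x))) s'%:E.
  by rewrite -/zmin -sE lte_fin.
by exists x; exact: ltW.
Qed.

End LowerBound.

Section ClimbCost.
Context {R : realType}.
Local Notation mu := (@lebesgue_measure R).
Variable z : R -> \bar R.
Hypothesis z_ge0 : forall x : R, 0 <= x -> (0 <= z x)%E.
Hypothesis z_noninc : nonincreasing0 z.
Local Notation G := (convol (g_of z) (@r_ker R)).
Implicit Types (t h a b : R).

Lemma integral_sqrt a b : 0 <= a -> a <= b ->
  (\int[mu]_(h in `]a, b]) (3 / 2 * Num.sqrt h)%:E
    = (b * Num.sqrt b - a * Num.sqrt a)%:E)%E.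
Proof.
move=> a0; rewrite le_eqVlt => /predU1P[->|ab].
  by rewrite set_itv_ge ?integral_set0 ?subrr// bnd_simp ltxx.
pose F h := h * Num.sqrt h.
apply: (@ge0_continuous_FTC2_oc _ (fun h => 3 / 2 * Num.sqrt h) F _ _ ab).
- by move=> h _; rewrite mulr_ge0// sqrtr_ge0.
- by move=> h _; apply: cvgMl_tmp; exact: sqrt_continuous.
- move=> h /andP[ah _]; have h0 : 0 < h by exact: le_lt_trans ah.
  apply: is_derive_eq (is_deriveM (is_derive_id h (1 : R)) (is_derive1_sqrt h0)) _.
  rewrite /GRing.scale/=; have := sqr_sqrtr (ltW h0).
  have : Num.sqrt h != 0 by rewrite sqrtr_eq0 -ltNge.
  by set r := Num.sqrt h => r0 <-; field.
- by apply: cvg_at_right_filter; apply: cvgM; [exact: cvg_id|exact: sqrt_continuous].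
Qed.

Definition climb_density t h : \bar R := ((3 / 2 * Num.sqrt h)%:E * r_ker_mass t (z h))%E.

Definition climb_cost t a : \bar R := (\int[mu]_(h in `]a, +oo[) climb_density t h)%E.

Lemma climb_density_ge0 t h : (0 <= climb_density t h)%E.
Proof. by rewrite mule_ge0 ?r_ker_mass_ge0// lee_fin mulr_ge0// sqrtr_ge0. Qed.

Lemma climb_cost_ge0 t a : (0 <= climb_cost t a)%E.
Proof. by apply: integral_ge0 => h _; exact: climb_density_ge0. Qed.

Lemma measurable_sqrt (A : set R) :
  measurable_fun A (fun h : R => (3 / 2 * Num.sqrt h)%:E).
Proof.
apply: measurable_funTS; apply/measurable_EFinP; apply: measurable_funM => //.
by apply: continuous_measurable_fun; exact: sqrt_continuous.
Qed.

Lemma measurable_climb_density t a : 0 <= a ->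
  measurable_fun (`]a, +oo[%classic : set R) (climb_density t).
Proof.
move=> a0; apply: emeasurable_funM; first exact: measurable_sqrt.
apply: nonincreasing_emeasurable => [|x y]; first exact: interval_is_interval.
rewrite !inE/= !in_itv/= !andbT => ax _ xy; apply: le_r_ker_mass.
by apply: z_noninc => //; exact: le_trans (ltW ax).
Qed.

Lemma climb_cost_le_convol t : (climb_cost t 0 <= G t)%E.
Proof.
pose pos : set R := `]0, +oo[%classic.
have mz : measurable_fun pos z.
  apply: measurable_funS (measurable_noninc0 z_noninc) => //.
  by apply: subset_itvr; rewrite bnd_simp.
have mpos : measurable pos by exact: measurable_itv.
have mker : measurable_fun setT (fun s : R => (r_ker (t - s))%:E).
  by apply/measurable_EFinP; exact: measurable_r_ker_sub.
have ker0 s : (0 <= (r_ker (t - s))%:E)%E by rewrite lee_fin r_ker_ge0.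
rewrite /climb_cost /climb_density (layer_cake mpos (@measurable_sqrt pos) mz mker)//.
apply: ge0_le_integral_subset => // s _.
- by rewrite mule_ge0// integral_ge0.
- by rewrite mule_ge0// g_of_ge0.
rewrite muleC lee_wpmul2r//.
have := gen_inv_ge0 z s; case mE : (gen_inv z s) => [m| |]// m0.
  rewrite (g_of_fin mE) lee_fin in m0 *.
  have -> : m * Num.sqrt m = m * Num.sqrt m - 0 * Num.sqrt 0 by rewrite mul0r subr0.
  rewrite -integral_sqrt//; apply: ge0_le_integral_subset => // h [].
  rewrite /pos/= !in_itv/= andbT => h0 /(gen_inv_ge z_noninc).
  by rewrite mE lee_fin h0.
by rewrite /g_of mE poweRyr ?leey// mulf_neq0 ?invr_eq0.
Qed.

Lemma climb_cost_cat_ge t (K : \bar R) a b : 0 <= a -> a <= b -> (K <= z b)%E ->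
  ((b * Num.sqrt b - a * Num.sqrt a)%:E * r_ker_mass t K + climb_cost t b
    <= climb_cost t a)%E.
Proof.
move=> a0 ab Kz; have b0 : 0 <= b by exact: le_trans ab.
rewrite [leRHS](@integral_itv_cat _ _ _ _ b)//; last exact: measurable_climb_density.
apply: leeD; last first.
  rewrite /climb_cost integral_itv_obnd_cbnd//; exact: measurable_climb_density.
rewrite -integral_sqrt// -ge0_integralZr; first last.
- exact: r_ker_mass_ge0.
- by move=> h _; rewrite lee_fin mulr_ge0// sqrtr_ge0.
- exact: measurable_sqrt.
- exact: measurable_itv.
apply: ge0_le_integral_subset => // h.
- by move=> _; rewrite mule_ge0 ?r_ker_mass_ge0// lee_fin mulr_ge0// sqrtr_ge0.
- by move=> _; exact: climb_density_ge0.
rewrite /= in_itv/= => /andP[ah hb]; rewrite lee_wpmul2l ?lee_fin ?mulr_ge0 ?sqrtr_ge0//.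
by apply: le_r_ker_mass; apply: le_trans Kz _; apply: z_noninc => //; exact: le_trans (ltW ah).
Qed.

Lemma pow32_r_ker_mass_le_convol t (K h : R) : 0 <= h -> (K%:E <= z h)%E ->
  ((h * Num.sqrt h * (4 / 3 * Num.sqrt 2 * Num.sqrt (K - t)))%:E <= G t)%E.
Proof.
move=> h0 Kz; apply: le_trans (climb_cost_le_convol t).
apply: le_trans (climb_cost_cat_ge t (lexx 0) h0 Kz).
by rewrite r_ker_massE mul0r subr0 EFinM leeDl// climb_cost_ge0.
Qed.

Lemma convol_lty_profile_lty t h : (G t < +oo)%E -> 0 < h -> (z h < +oo)%E.
Proof.
move=> Goo h0; rewrite ltNge leye_eq; apply/negP => /eqP zh.
have G0 := convol_ge0 z t; have Gfin : G t \is a fin_num by rewrite ge0_fin_numE.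
pose c := h * Num.sqrt h * (4 / 3 * Num.sqrt 2).
have c0 : 0 < c by rewrite !mulr_gt0 ?sqrtr_gt0.
pose A := (fine (G t) + 1) / c.
have A0 : 0 <= A by rewrite divr_ge0 ?addr_ge0 ?fine_ge0 ?(ltW c0).
have := @pow32_r_ker_mass_le_convol t (t + A ^+ 2) h (ltW h0).
rewrite zh leey addrAC subrr add0r sqrtr_sqr ger0_norm// => /(_ isT).
by rewrite mulrA -/c mulrC divfK ?gt_eqF// -[leRHS]fineK// lee_fin; lra.
Qed.

Lemma convol_lty_profile_le t s : (G t < +oo)%E -> t < s ->
  exists2 h, 0 < h & (z h <= s%:E)%E.
Proof.
move=> Goo ts; apply: contrapT => zbig.
have sz h : 0 < h -> (s%:E <= z h)%E.
  by move=> h0; rewrite leNgt; apply/negP => zh; apply: zbig; exists h => //; exact: ltW.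
have G0 := convol_ge0 z t; have Gfin : G t \is a fin_num by rewrite ge0_fin_numE.
pose c := 4 / 3 * Num.sqrt 2 * Num.sqrt (s - t).
have c0 : 0 < c by rewrite !mulr_gt0 ?sqrtr_gt0 ?subr_gt0.
pose h := 1 + (fine (G t) + 1) / c.
have h1 : 1 <= h by rewrite lerDl divr_ge0 ?addr_ge0 ?fine_ge0 ?(ltW c0).
have h0 : 0 < h by exact: lt_le_trans h1.
have := pow32_r_ker_mass_le_convol t (ltW h0) (sz _ h0).
rewrite -/c -[leRHS]fineK// lee_fin leNgt => /negP; apply.
apply: (@lt_le_trans _ _ (h * c)).
  by rewrite /h mulrDl divfK ?gt_eqF// mul1r; lra.
rewrite ler_wpM2r ?(ltW c0)// ler_peMr ?(ltW h0)//.
by rewrite -[leLHS]sqrtr1 ler_wsqrtr.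
Qed.

End ClimbCost.

Section Ascents.
Context {R : realType}.
Local Notation mu := (@lebesgue_measure R).
Variable z : R -> \bar R.
Hypothesis z_ge0 : forall x : R, 0 <= x -> (0 <= z x)%E.
Hypothesis z_noninc : nonincreasing0 z.
Implicit Types (f D : R -> R) (s t h a : R) (C : \bar R).

Lemma energy_density_glue c f1 D1 f2 D2 :
  energy_density z (glue c f1 f2) (glue c D1 D2) =
  glue c (energy_density z f1 D1) (energy_density z f2 D2).
Proof. by apply/funext => x; rewrite /energy_density /glue; case: ifP. Qed.

Lemma EFin_glue c f1 f2 : EFin \o glue c f1 f2 = glue c (EFin \o f1) (EFin \o f2).
Proof. by apply/funext => x; rewrite /glue/=; case: ifP. Qed.

Definition ascends s C a h f D :=
  [/\ ac_deriv f D, f a = h, forall x, a <= x -> h <= f x &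
    forall x, a <= x -> (\int[mu]_(y in `[a, x]) energy_density z f D y <=
      s%:E * \int[mu]_(y in `[a, x]) (f y)%:E + C)%E].

Lemma ascends_le s C C' a h f D : (C <= C')%E ->
  ascends s C a h f D -> ascends s C' a h f D.
Proof.
move=> CC' [acf fa fh fE]; split => // x ax.
by apply: le_trans (fE x ax) _; rewrite leeD2l.
Qed.

Lemma ascends_plateau s C a h : 0 <= h -> (z h <= s%:E)%E -> (0 <= C)%E ->
  ascends s C a h (cst h) (cst 0).
Proof.
move=> h0 zh C0; split => [| // | // |x ax]; first exact: ac_deriv_cst.
have s0 : 0 <= s by rewrite -lee_fin (le_trans (z_ge0 h0)).
rewrite -[leLHS]adde0; apply: leeD => //.
rewrite -ge0_integralZl_EFin//; last exact/measurable_EFinP.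
apply: ge0_le_integral_subset => // y _.
- exact: energy_density_ge0.
- by rewrite mule_ge0 ?lee_fin.
- by rewrite energy_densityE// expr0n/= mulr0 add0e lee_wpmul2r ?lee_fin.
Qed.

Lemma affine_energy_le s (K p : R) a x h h' : 0 <= s -> 0 <= h -> 0 < p -> a <= x ->
  h + p * (x - a) <= h' -> (z h <= K%:E)%E -> (K - s) * h' <= 2^-1 * p ^+ 2 ->
  (\int[mu]_(y in `[a, x]) energy_density z (fun y => h + p * (y - a))%R (cst p) y <=
   s%:E * \int[mu]_(y in `[a, x]) (h + p * (y - a))%:E + (p * (h' - h))%:E)%E.
Proof.
move=> s0 h0 p0 ax xh' zK Kp; pose f y := h + p * (y - a).
have hf y : a <= y -> h <= f y by move=> ay; rewrite lerDl mulr_ge0 ?subr_ge0 ?(ltW p0).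
have fh' y : y <= x -> f y <= h'.
  by move=> yx; apply: le_trans xh'; rewrite lerD2l ler_pM2l// lerD2r.
have mf : measurable_fun setT f by exact: ac_deriv_measurable_fun (ac_deriv_affine h p a).
have mfE : measurable_fun (`[a, x]%classic : set R) (EFin \o f).
  by apply/measurable_EFinP; exact: measurable_funS mf.
have f0 y : `[a, x]%classic y -> (0 <= (f y)%:E)%E.
  by rewrite /= in_itv/= lee_fin => /andP[/hf hy _]; exact: le_trans hy.
apply: (@le_trans _ _ (\int[mu]_(y in `[a, x]) (s%:E * (f y)%:E + (p ^+ 2)%:E))%E).
  apply: ge0_le_integral_subset => // y ay; first exact: energy_density_ge0.
    by rewrite adde_ge0 ?mule_ge0 ?f0// lee_fin sqr_ge0.
  have fy0 : 0 <= f y by rewrite -lee_fin f0.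
  move: ay; rewrite /= in_itv/= => /andP[ay yx].
  rewrite energy_densityE//; apply: (@le_trans _ _ ((2^-1 * p ^+ 2)%:E + K%:E * (f y)%:E)%E).
    rewrite leeD2l// lee_wpmul2r ?lee_fin//; apply: le_trans zK.
    by apply: z_noninc => //; exact: hf.
  rewrite -!EFinM -!EFinD lee_fin.
  have [sK|Ks] := leP s K.
    by have := ler_wpM2l (_ : 0 <= K - s) (fh' y yx); rewrite subr_ge0 => /(_ sK); lra.
  have := ler_wpM2r fy0 (ltW Ks); have := sqr_ge0 p; lra.
rewrite ge0_integralD//; first last.
- by move=> y _; rewrite lee_fin sqr_ge0.
- exact: measurable_funeM.
- by move=> y ay; rewrite mule_ge0 ?f0.
rewrite ge0_integralZl_EFin// integral_cst_itv// leeD2l// lee_fin expr2 -mulrA.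
by rewrite ler_pM2l// lerBrDl.
Qed.

Lemma ascends_climb s C (K p : R) a h h' f D : 0 <= s -> 0 <= h -> h <= h' -> 0 < p ->
  (z h <= K%:E)%E -> (K - s) * h' <= 2^-1 * p ^+ 2 -> (0 <= C)%E ->
  let c := a + (h' - h) / p in ascends s C c h' f D ->
  ascends s ((p * (h' - h))%:E + C) a h
    (glue c (fun x => h + p * (x - a)) f) (glue c (cst p) D).
Proof.
move=> s0 h0 hh' p0 zK Kp C0 c [acf fc fh' fE]; pose line x := h + p * (x - a).
have ac_line : ac_deriv line (cst p) by exact: ac_deriv_affine.
have ac : a <= c by rewrite lerDl divr_ge0 ?subr_ge0 ?(ltW p0).
have linec : line c = h'.
  by rewrite /line /c addrAC subrr add0r mulrC divfK ?gt_eqF// addrC subrK.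
have ac_g := ac_deriv_glue (etrans linec (esym fc)) ac_line acf.
have line_le x : x <= c -> line x <= h'.
  by move=> xc; rewrite -linec lerD2l ler_pM2l// lerD2r.
split => //.
- by rewrite /glue ac subrr mulr0 addr0.
- move=> x ax; rewrite /glue; case: ifPn => [_|].
    by rewrite lerDl mulr_ge0 ?subr_ge0 ?(ltW p0).
  by rewrite -ltNge => /ltW/fh'; exact: le_trans.
move=> x ax; have [xc|/ltW cx] := leP x c.
  rewrite energy_density_glue integral_glue_le// [X in (_ * X)%E](_ : _ =
    \int[mu]_(y in `[a, x]) (line y)%:E)%E; last first.
    by rewrite -(integral_glue_le (EFin \o line) (EFin \o f) _ xc) -EFin_glue.
  apply: (le_trans (affine_energy_le s0 h0 p0 ax (line_le x xc) zK Kp)).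
  by rewrite leeD2l// leeDl.
have mline := ac_deriv_measurable_fun ac_line; have mf := ac_deriv_measurable_fun acf.
rewrite energy_density_glue integral_glue ?bnd_simp//; last 2 first.
- by apply: measurable_energy_density => //; exact: ac_deriv_measurable ac_line.
- by apply: measurable_energy_density => //; exact: ac_deriv_measurable acf.
rewrite [X in (_ * X)%E](_ : _ = \int[mu]_(y in `[a, c]) (line y)%:E +
    \int[mu]_(y in `[c, x]) (f y)%:E)%E; last first.
  rewrite -(@integral_glue _ (EFin \o line) (EFin \o f)) ?bnd_simp//.
  - by rewrite -EFin_glue.
  - exact/measurable_EFinP.
  - exact/measurable_EFinP.
rewrite ge0_muleDr; last 2 first.
- apply: integral_ge0 => y; rewrite /= in_itv/= => /andP[ay _].
  by rewrite lee_fin addr_ge0// mulr_ge0 ?subr_ge0 ?(ltW p0).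
- apply: integral_ge0 => y; rewrite /= in_itv/= => /andP[cy _].
  by rewrite lee_fin (le_trans _ (fh' y cy))// (le_trans h0).
apply: le_trans (leeD (affine_energy_le s0 h0 p0 ac (line_le c (lexx c)) zK Kp) (fE x cx)) _.
by rewrite addeACA.
Qed.

Lemma climb_step_le (c l r : R) : 0 <= c -> 1 < l -> 0 <= r ->
  l * c * r * (r ^+ 2 * l ^+ 2 - r ^+ 2) <=
  l ^+ 4 / 2 * ((r ^+ 2 * r - r ^+ 2 / l ^+ 2 * (r / l)) * (4 / 3 * c)).
Proof.
move=> c0 l1 r0; have l0 : 0 < l by exact: lt_trans l1.
rewrite -subr_ge0 (_ : _ - _ = 1 / 3 * (c * r ^+ 3) * l * (l - 1) ^+ 2 * (2 * l + 1)).
  by rewrite !mulr_ge0 ?exprn_ge0 ?subr_ge0 ?addr_ge0 ?(ltW l1)// ?mulr_ge0// ltW.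
by field; rewrite gt_eqF.
Qed.

(* Up to the factor [l], the slope at which kinetic and excess potential energy agree. *)
Definition climb_slope (l A h : R) := l * (Num.sqrt 2 * Num.sqrt A) * Num.sqrt h.

Lemma climb_slope_gt0 (l A h : R) : 0 < l -> 0 < A -> 0 < h -> 0 < climb_slope l A h.
Proof. by move=> l0 A0 h0; rewrite !mulr_gt0 ?sqrtr_gt0. Qed.

Lemma half_sqr_climb_slope (l A h : R) : 0 <= A -> 0 <= h ->
  2^-1 * climb_slope l A h ^+ 2 = A * (h * l ^+ 2).
Proof. by move=> A0 h0; rewrite /climb_slope !exprMn !sqr_sqrtr//; field. Qed.

Lemma climb_slope_cost_le (K : R) t l h : 1 < l -> 0 < h -> (K%:E <= z h)%E ->
  ((climb_slope l (K - t) h * (h * l ^+ 2 - h))%:E + (l ^+ 4 / 2)%:E * climb_cost z t h <=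
   (l ^+ 4 / 2)%:E * climb_cost z t (h / l ^+ 2))%E.
Proof.
move=> l1 h0 Kz; have l0 : 0 < l by exact: lt_trans l1.
have l20 : 0 < l ^+ 2 by rewrite exprn_gt0.
have hl0 : 0 <= h / l ^+ 2 by rewrite divr_ge0 ?ltW.
have hl : h / l ^+ 2 <= h by rewrite ler_pdivrMr// ler_peMr ?(ltW h0)// exprn_ege1// ltW.
have l42 : 0 < l ^+ 4 / 2 by rewrite divr_gt0 ?exprn_gt0.
have := climb_cost_cat_ge z_noninc t hl0 hl Kz.
rewrite -(@lee_pmul2l _ (l ^+ 4 / 2)%:E) ?lte_fin//; apply: le_trans.
rewrite [leRHS]ge0_muleDr ?climb_cost_ge0//; last first.
  rewrite mule_ge0 ?r_ker_mass_ge0// lee_fin subr_ge0 ler_pM ?sqrtr_ge0//.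
  exact: ler_wsqrtr.
rewrite leeD2r// r_ker_massE -!EFinM lee_fin.
have c0 : 0 <= Num.sqrt 2 * Num.sqrt (K - t) by rewrite mulr_ge0 ?sqrtr_ge0.
have -> : Num.sqrt (h / l ^+ 2) = Num.sqrt h / l.
  by rewrite sqrtrM ?(ltW h0)// sqrtrV ?(ltW l20)// sqrtr_sqr gtr0_norm.
rewrite -[4 / 3 * _ * _]mulrA; have := climb_step_le c0 l1 (sqrtr_ge0 h).
by rewrite sqr_sqrtr ?(ltW h0).
Qed.

(* Climb linearly between the heights [h * l ^+ (2 * i)] until [z <= s]. *)
Lemma exists_ascent t s l n h a : t < s -> 1 < l -> 0 < h -> (z h < +oo)%E ->
  (z (h * (l ^+ 2) ^+ n) <= s%:E)%E ->
  exists f D, ascends s ((l ^+ 4 / 2)%:E * climb_cost z t (h / l ^+ 2)) a h f D.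
Proof.
move=> ts l1 h0; have l0 : 0 < l by exact: lt_trans l1.
have cost0 b : (0 <= (l ^+ 4 / 2)%:E * climb_cost z t b)%E.
  by rewrite mule_ge0 ?climb_cost_ge0// lee_fin divr_ge0// exprn_ge0 ?ltW.
elim: n h h0 a => [|n IH] h h0 a zhoo zhn.
  exists (cst h), (cst 0); apply: ascends_plateau => //; first exact: ltW.
  by move: zhn; rewrite expr0 mulr1.
have [zs|sz] := leP (z h) s%:E.
  by exists (cst h), (cst 0); apply: ascends_plateau => //; exact: ltW.
pose K := fine (z h); have KE : K%:E = z h by rewrite fineK// ge0_fin_numE// z_ge0// ltW.
have sK : s < K by rewrite -lte_fin KE.
have s0 : 0 <= s.
  by rewrite -lee_fin (le_trans _ zhn)// z_ge0// mulr_ge0 ?exprn_ge0 ?ltW.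
have Kt0 : 0 < K - t by lra.
pose h' := h * l ^+ 2; pose p := climb_slope l (K - t) h.
have p0 : 0 < p by exact: climb_slope_gt0.
have hh' : h <= h' by rewrite ler_peMr ?(ltW h0)// exprn_ege1// ltW.
have h'0 : 0 < h' by exact: lt_le_trans hh'.
have [||f [D asc]] := IH h' h'0 (a + (h' - h) / p).
- by apply: le_lt_trans zhoo; apply: z_noninc => //; exact: ltW.
- by rewrite -mulrA -exprS.
rewrite /h' mulfK ?gt_eqF ?exprn_gt0// in asc.
exists (glue (a + (h' - h) / p) (fun x => h + p * (x - a)) f),
  (glue (a + (h' - h) / p) (cst p) D).
have Kp : (K - s) * h' <= 2^-1 * p ^+ 2.
  by rewrite half_sqr_climb_slope ?(ltW h0) ?(ltW Kt0)// ler_wpM2r ?(ltW h'0)// lerD2l lerN2 ltW.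
have [zK Kz] : (z h <= K%:E)%E /\ (K%:E <= z h)%E by rewrite KE.
by apply: ascends_le (ascends_climb s0 (ltW h0) hh' p0 zK Kp (cost0 _) asc);
  exact: climb_slope_cost_le.
Qed.

End Ascents.

Section Tails.
Context {R : realType}.
Local Notation mu := (@lebesgue_measure R).
Implicit Types (f D : R -> R) (d : R).

Lemma integral_ray_small (h : R -> \bar R) (c : nat -> R) d :
  measurable_fun setT h -> (forall x, 0 <= h x)%E -> (\int[mu]_x h x < +oo)%E ->
  {homo c : i j / (i <= j)%N >-> j <= i} ->
  (forall x, (forall n, x <= c n) -> h x = 0%E) -> 0 < d ->
  exists n, (\int[mu]_(x in `]-oo, c n]) h x <= d%:E)%E.
Proof.
move=> mh h0 hoo c_noninc h_out d0; apply: contrapT => /forallNP big.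
pose F n : set R := `[c n, +oo[%classic; set I := (\int[mu]_x h x)%E in hoo.
have Ifin : I \is a fin_num by rewrite ge0_fin_numE// integral_ge0.
have IE n : I = (\int[mu]_(x in `]-oo, c n]) h x + \int[mu]_(x in F n) h x)%E.
  by rewrite -integral_itv_cat// set_itvNyy.
have : (\int[mu]_(x in F i) h x)%E @[i --> \oo] --> (\int[mu]_(x in \bigcup_i F i) h x)%E.
  apply: ge0_nondecreasing_set_cvg_integral => [i j ij|i|i|i x _].
  - by apply/subsetPset; apply: subset_itvr; rewrite bnd_simp c_noninc.
  - exact: measurable_itv.
  - exact: measurable_funS mh.
  - exact: h0.
have -> : (\int[mu]_(x in \bigcup_i F i) h x = I)%E.
  rewrite integral_mkcond; apply: eq_integral => x _; rewrite patchE.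
  case: ifPn => //; rewrite notin_setE => xF; rewrite h_out// => n.
  by rewrite leNgt; apply/negP => cx; apply: xF; exists n; rewrite // /F/= in_itv/= andbT ltW.
move=> cvgI; have : (limn (fun i => \int[mu]_(x in F i) h x) <= I - d%:E)%E.
  apply: lime_le; first by apply/cvg_ex; exists I.
  apply: nearW => n; rewrite leeBrDr// addeC (IE n) leeD2r// ltW// ltNge.
  by apply/negP; exact: big.
by rewrite (cvg_lim _ cvgI)// -(fineK Ifin) -EFinB lee_fin; lra.
Qed.

(* [c] decreases to the infimum of the support of [f], possibly [-oo]. *)
Lemma ac_deriv_left_support f D : ac_deriv f D -> (forall x, 0 <= f x) ->
  (exists x, 0 < f x) ->
  exists D' (c : nat -> R), [/\ ac_deriv f D', forall x, D' x = D x \/ D' x = 0,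
    {homo c : i j / (i <= j)%N >-> j <= i}, forall n, exists2 a, a <= c n & 0 < f a &
    forall x, (forall n, x <= c n) -> f x = 0 /\ D' x = 0].
Proof.
move=> acf f0 [p fp]; pose supp := [set x | 0 < f x].
have outE x : ~ supp x -> f x = 0.
  by move=> /negP; rewrite -leNgt => fx; apply/eqP; rewrite eq_le fx f0.
have [[y suppy]|unbounded] := pselect (has_lbound supp); last first.
  exists D, (fun n => - n%:R); split => //.
  - by move=> x; left.
  - by move=> i j ij; rewrite lerN2 ler_nat.
  - move=> n; apply: contrapT => noa; apply: unbounded; exists (- n%:R) => x suppx.
    by rewrite leNgt; apply/negP => xn; apply: noa; exists x => //; exact: ltW.
  - move=> x xn; exfalso; have := xn (Num.bound `|x|).
    have := archi_boundP (normr_ge0 x); have := ler_norm (- x); rewrite normrN; lra.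
have lsupp : has_inf supp by split; [exists p|exists y].
pose b := inf supp.
have left0 x : x < b -> f x = 0.
  move=> xb; apply: outE => /(ge_inf (proj2 lsupp)); by rewrite leNgt xb.
have fb : f b = 0.
  have fb0 : f x @[x --> b^'-] --> 0.
    by apply: cvg_near_cst; near=> x; apply: left0; near: x; exact: nbhs_left_lt.
  have /cvg_at_left_filter fb := @ac_deriv_continuous _ _ _ acf b.
  by rewrite -(cvg_lim _ fb0)// -(cvg_lim _ fb).
have ac0 := @ac_deriv_glue _ b (cst 0) (cst 0) f D (esym fb) (@ac_deriv_cst R 0) acf.
have glue0 : glue b (cst 0) f = f.
  apply/funext => x; rewrite /glue le_eqVlt; case: eqVneq => [->//|_] /=.
  by case: ifP => // /left0.
rewrite glue0 in ac0; exists (glue b (cst 0) D), (fun n => b + n.+1%:R^-1); split => //.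
- by move=> x; rewrite /glue; case: ifP; [right|left].
- by move=> i j ij; rewrite lerD2l lef_pV2 ?posrE// ler_nat.
- move=> n; have [|a fa ab] := @inf_adherent _ supp n.+1%:R^-1 _ lsupp.
    by rewrite invr_gt0.
  by exists a => //; exact: ltW.
- move=> x xc; have xb : x <= b.
    apply/ler_addgt0Pr => e e0; have [n _ ne] := near_infty_natSinv_lt (PosNum e0).
    by apply: (le_trans (xc n)); rewrite lerD2l ltW// (ne n)/=.
  by rewrite -glue0 /glue xb.
Unshelve. all: by end_near. Qed.

End Tails.

Section HalfProfiles.
Context {R : realType}.
Local Notation mu := (@lebesgue_measure R).
Variable z : R -> \bar R.
Hypothesis z_ge0 : forall x : R, 0 <= x -> (0 <= z x)%E.
Hypothesis z_noninc : nonincreasing0 z.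
Local Notation G := (convol (g_of z) (@r_ker R)).
Implicit Types (f D : R -> R) (s t l d w : R).

Lemma exists_small_tail f D w d : ac_deriv f D -> (forall x, 0 <= f x) -> 0 < w ->
  (\int[mu]_x (f x)%:E = w%:E)%E -> (\int[mu]_x energy_density z f D x < +oo)%E -> 0 < d ->
  exists a D', [/\ ac_deriv f D', 0 < f a, (\int[mu]_(x in `]-oo, a]) (f x)%:E <= d%:E)%E &
    (\int[mu]_(x in `]-oo, a]) energy_density z f D' x <= d%:E)%E].
Proof.
move=> acf f0 w0 fw Eoo d0; have mf := ac_deriv_measurable_fun acf.
have mfE : measurable_fun setT (EFin \o f) by exact/measurable_EFinP.
have fpos : exists x, 0 < f x.
  apply: contrapT => /forallNP noneg; have : (\int[mu]_x (f x)%:E = 0)%E.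
    apply: integral0_eq => x _; congr EFin; apply/eqP; rewrite eq_le f0 andbT leNgt.
    by apply/negP; exact: noneg.
  by rewrite fw => -[w00]; rewrite w00 ltxx in w0.
have [D' [c [acf' D'E c_noninc cf c_out]]] := ac_deriv_left_support acf f0 fpos.
have me := measurable_energy_density z_noninc mf (ac_deriv_measurable acf').
have e0 x : (0 <= energy_density z f D' x)%E by exact: energy_density_ge0.
pose h x := ((f x)%:E + energy_density z f D' x)%E.
have [|||x /c_out[fx Dx]|n hn] := @integral_ray_small _ h c d _ _ _ c_noninc _ d0.
- exact: emeasurable_funD.
- by move=> x; rewrite adde_ge0 ?lee_fin.
- rewrite ge0_integralD//; last by move=> x _; rewrite lee_fin.
  rewrite fw lte_add_pinfty ?ltry//; apply: le_lt_trans Eoo.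
  apply: ge0_le_integral_subset => // x _; first exact: energy_density_ge0.
  rewrite leeD2r// lee_fin ler_pM2l ?invr_gt0//.
  by have [->|->] := D'E x; rewrite // expr0n sqr_ge0.
- by rewrite /h energy_density00// fx add0e.
have [a ac fa] := cf n; exists a, D'; split => //; apply: le_trans hn;
  apply: ge0_le_integral_subset => //.
- by apply: subset_itvl; rewrite bnd_simp.
- by move=> x _; rewrite lee_fin.
- by move=> x _; rewrite adde_ge0 ?lee_fin.
- by move=> x _; rewrite leeDl.
- by apply: subset_itvl; rewrite bnd_simp.
- by move=> x _; rewrite adde_ge0 ?lee_fin.
- by move=> x _; rewrite leeDr ?lee_fin.
Qed.

Lemma exists_expr_ge (q h m : R) : 1 < q -> 0 < h -> exists n, m <= h * q ^+ n.
Proof.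
move=> q1 h0; have q0 : 0 < q by exact: lt_trans q1.
have q1' : `|q^-1| < 1 by rewrite gtr0_norm ?invr_gt0// invf_lt1.
have /cvgr_lt/(_ h h0)[n _ /(_ n (leqnn n))/=] := cvg_geometric m q1'.
rewrite /geometric/= exprVn ltr_pdivrMr ?exprn_gt0// => mn.
by exists n; exact: ltW.
Qed.

Lemma exists_half_profile f D w d t s l : ac_deriv f D -> (forall x, 0 <= f x) -> 0 < w ->
  (\int[mu]_x (f x)%:E = w%:E)%E -> (\int[mu]_x energy_density z f D x < +oo)%E ->
  0 < d -> t < s -> 1 < l -> (G t < +oo)%E ->
  exists a h g Dg, [/\ ac_deriv g Dg, forall x, 0 <= g x, 0 < h /\ forall x, a <= x -> h <= g x,
    (\int[mu]_(x in `]-oo, a]) (g x)%:E <= d%:E)%E &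
    forall x, a <= x -> (\int[mu]_(y in `]-oo, x]) energy_density z g Dg y <=
      d%:E + s%:E * \int[mu]_(y in `]-oo, x]) (g y)%:E + (l ^+ 4 / 2)%:E * G t)%E].
Proof.
move=> acf f0 w0 fw Eoo d0 ts l1 Goo; have l0 : 0 < l by exact: lt_trans l1.
have [a [D1 [ac1 fa mass_a energy_a]]] := exists_small_tail acf f0 w0 fw Eoo d0.
have l21 : 1 < l ^+ 2 by rewrite exprn_egt1.
have [m m0 zm] := convol_lty_profile_le z_noninc Goo ts.
have [n mn] := exists_expr_ge m l21 fa.
have zh := convol_lty_profile_lty z_noninc Goo fa.
have zn := le_trans (z_noninc (ltW m0) mn) zm.
have [f2 [D2 [ac2 f2a f2ge f2E]]] := exists_ascent z_ge0 z_noninc a ts l1 fa zh zn.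
have acg := ac_deriv_glue (esym f2a) ac1 ac2; set g := glue a f f2 in acg.
exists a, (f a), g, (glue a D1 D2).
have g0 x : 0 <= g x.
  by rewrite /g /glue; have [//|/ltW/f2ge] := leP x a; apply: le_trans; exact: ltW.
have s0 : 0 <= s by rewrite -lee_fin (le_trans (z_ge0 (ltW m0))).
split => //.
- by split=> // x ax; rewrite /g glue_ge// f2ge.
- by rewrite (_ : (fun x => _) = glue a (EFin \o f) (EFin \o f2)) ?integral_glue_le// -EFin_glue.
move=> x ax; rewrite energy_density_glue integral_glue ?bnd_simp//; last 2 first.
- by apply: measurable_energy_density => //;
    [exact: ac_deriv_measurable_fun ac1|exact: ac_deriv_measurable ac1].
- by apply: measurable_energy_density => //;
    [exact: ac_deriv_measurable_fun ac2|exact: ac_deriv_measurable ac2].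
rewrite -[leRHS]addeA; apply: (le_trans (leeD energy_a (f2E x ax))); rewrite leeD2l// leeD//.
  rewrite lee_wpmul2l ?lee_fin//.
  apply: ge0_le_integral_subset => //.
  - by apply: subset_itvr; rewrite bnd_simp.
  - move=> y; rewrite /= in_itv/= => /andP[/f2ge fy _].
    by rewrite lee_fin (le_trans _ fy)// ltW.
  - by move=> y _; rewrite lee_fin.
  - by move=> y; rewrite /= in_itv/= => /andP[ay _]; rewrite /g glue_ge.
rewrite lee_wpmul2l ?lee_fin ?divr_ge0 ?exprn_ge0 ?(ltW l0)//.
apply: le_trans (climb_cost_le_convol z_noninc t).
apply: ge0_le_integral_subset => //; [|by move=> *; exact: climb_density_ge0..].
by apply: subset_itvr; rewrite bnd_simp divr_ge0 ?ltW// exprn_gt0.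
Qed.

End HalfProfiles.

Section Competitors.
Context {R : realType}.
Local Notation mu := (@lebesgue_measure R).
Variable z : R -> \bar R.
Hypothesis z_ge0 : forall x : R, 0 <= x -> (0 <= z x)%E.
Hypothesis z_noninc : nonincreasing0 z.
Local Notation G := (convol (g_of z) (@r_ker R)).
Implicit Types (f g D : R -> R) (s t l d w : R).

Lemma tau_z_ge0 w : (0 <= tau_z z w)%E.
Proof.
apply: le_ereal_inf_tmp => _ [psi _ <-]; apply: le_ereal_inf_tmp => _ [dpsi _ <-].
by apply: integral_ge0 => y _; exact: energy_density_ge0.
Qed.

Lemma tau_z_le f D w : ac_deriv f D -> (forall x, 0 <= f x) ->
  (\int[mu]_x (f x)%:E = w%:E)%E -> (tau_z z w <= \int[mu]_x energy_density z f D x)%E.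
Proof.
move=> acf f0 fw; apply: (@le_trans _ _ (energy (c_of z) f)).
  by apply: ereal_inf_lbound; exists f.
by apply: ereal_inf_lbound; exists D => //; exact: ac_deriv_weak.
Qed.

Lemma tau_z0_le0 : (tau_z z 0 <= 0)%E.
Proof.
apply: le_trans (tau_z_le (@ac_deriv_cst R 0) _ _) _ => //; first by rewrite integral0_eq.
by rewrite integral0_eq// => x _; rewrite energy_density00.
Qed.

Lemma continuous_ae_ge0 f : continuous f -> {ae mu, forall x, 0 <= f x} -> forall x, 0 <= f x.
Proof.
move=> cf [A [mA A0 sA]] x; rewrite leNgt; apply/negP => fx.
have /cvgr_lt/(_ _ fx)[/= e e0 fball] := cf x.
have ballA : ball x e `<=` A.
  by move=> y /fball fy; apply: sA => /=; rewrite leNgt fy.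
have : (mu (ball x e) <= mu A)%E by apply: le_measure => //; rewrite inE//; exact: measurable_ball.
by rewrite A0 lebesgue_measure_ball ?(ltW e0)// lee_fin mulr2n leNgt addr_gt0.
Qed.

Lemma ac_representative psi dpsi w : weak_deriv psi dpsi ->
  (forall y, 0 <= psi y) -> (\int[mu]_x (psi x)%:E = w%:E)%E ->
  exists f, [/\ ac_deriv f dpsi, forall x, 0 <= f x, (\int[mu]_x (f x)%:E = w%:E)%E &
    (\int[mu]_x energy_density z f dpsi x = \int[mu]_x energy_density z psi dpsi x)%E].
Proof.
move=> wpsi psi0 psiw; have [[mpsi _ _] [[mdpsi _ _] _]] := wpsi.
have [f acf aef] := weak_deriv_ac wpsi; have mf := ac_deriv_measurable_fun acf.
have f0 : forall x, 0 <= f x.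
  apply: continuous_ae_ge0 (ac_deriv_continuous acf) _.
  by apply: (@filterS _ _ (ae_filter_ringOfSetsType mu) _ _ _ aef) => x <-.
have ae_eq_int (F : R -> R -> \bar R) :
    measurable_fun setT (fun x => F (f x) x) -> measurable_fun setT (fun x => F (psi x) x) ->
    (forall y x, (0 <= y)%R -> 0 <= F y x)%E ->
    (\int[mu]_x F (f x) x = \int[mu]_x F (psi x) x)%E.
  move=> mFf mFpsi F0; apply: ge0_ae_eq_integral => //; [by move=> *; exact: F0..|].
  by apply: (@filterS _ _ (ae_filter_ringOfSetsType mu) _ _ _ aef) => x -> _.
exists f; split; [exact: acf|exact: f0| |].
  by rewrite -psiw; apply: (ae_eq_int (fun y _ => y%:E)) => //; exact/measurable_EFinP.
apply: (ae_eq_int (fun y x => (2^-1 * dpsi x ^+ 2)%:E + c_of z `|y|)%E).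
- exact: measurable_energy_density.
- exact: measurable_energy_density.
- by move=> y x _; rewrite adde_ge0 ?c_of_ge0// lee_fin mulr_ge0// sqr_ge0.
Qed.

Lemma tau_z_lt w (e : \bar R) : (tau_z z w < e)%E -> exists f D,
  [/\ ac_deriv f D, forall x, 0 <= f x, (\int[mu]_x (f x)%:E = w%:E)%E &
      (\int[mu]_x energy_density z f D x < e)%E].
Proof.
move=> /ereal_inf_lt[_ [psi [psi0 psiw] <-]] /ereal_inf_lt[_ [dpsi wd <-]] lt_e.
have [f [acf f0 fw fE]] := ac_representative wd psi0 psiw.
by exists f, dpsi; split; [exact: acf|exact: f0|exact: fw|rewrite fE].
Qed.

Lemma exists_half_line_mass g (a h d m : R) : continuous g -> (forall x, 0 <= g x) ->
  0 < h -> (forall x, a <= x -> h <= g x) ->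
  (\int[mu]_(x in `]-oo, a]) (g x)%:E <= d%:E)%E -> d <= m ->
  exists2 x, a <= x & (\int[mu]_(y in `]-oo, x]) (g y)%:E = m%:E)%E.
Proof.
move=> cg g0 h0 gh; set m0 := (\int[mu]_(x in `]-oo, a]) _)%E => m0d dm.
have m0_ge0 : (0 <= m0)%E by apply: integral_ge0 => x _; rewrite lee_fin.
have m0fin : m0 \is a fin_num by rewrite ge0_fin_numE// (le_lt_trans m0d)// ltry.
have m0m : fine m0 <= m by rewrite -lee_fin fineK// (le_trans m0d).
have m_ge0 : 0 <= m by rewrite (le_trans _ m0m)// fine_ge0.
have ig x y : mu.-integrable `[x, y] (EFin \o g).
  by apply: continuous_compact_integrable; [exact: segment_compact|exact: continuous_subspaceT].
have intE x y : (\int[mu]_(u in `[x, y]) (g u)%:E = (parameterized_integral mu x y g)%:E)%E.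
  by rewrite /parameterized_integral /Rintegral fineK//; exact: integrable_fin_num.
pose b := a + m / h; have ab : a <= b by rewrite lerDl divr_ge0// ltW.
have [x] : exists2 x, x \in `[a, b] & parameterized_integral mu a x g = m - fine m0.
  apply: IVT => //; first exact: parameterized_integral_continuous.
  rewrite ge_min le_max; apply/andP; split; apply/orP; [left|right].
    by rewrite /parameterized_integral set_itv1 Rintegral_set1 subr_ge0.
  rewrite lerBlDr ler_wpDr ?fine_ge0// -lee_fin -intE.
  have -> : m = h * (b - a) by rewrite /b addrAC subrr add0r mulrC divfK// gt_eqF.
  rewrite -integral_cst_itv//; apply: ge0_le_integral_subset => // y.
  - by move=> _; rewrite lee_fin ltW.
  - by move=> _; rewrite lee_fin.
  - by rewrite /= in_itv/= lee_fin => /andP[/gh].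
rewrite in_itv/= => /andP[ax _] xm; exists x => //.
rewrite (@integral_itv_cat _ _ _ _ a)//; last first.
  apply: measurable_funTS; apply/measurable_EFinP; exact: continuous_measurable_fun.
by rewrite intE xm -/m0 -{1}(fineK m0fin) -EFinD subrKC.
Qed.

Lemma tau_z_double_le g D (x m : R) : ac_deriv g D -> (forall y, 0 <= g y) ->
  (\int[mu]_(y in `]-oo, x]) (g y)%:E = m%:E)%E ->
  (tau_z z (m + m) <= \int[mu]_(y in `]-oo, x]) energy_density z g D y +
                      \int[mu]_(y in `]-oo, x]) energy_density z g D y)%E.
Proof.
move=> acg g0 gm; have mg := ac_deriv_measurable_fun acg.
have acr := ac_deriv_reflect (x + x) acg.
have gx : g x = g (x + x - x) by rewrite addrK.
apply: le_trans (tau_z_le (ac_deriv_glue gx acg acr) _ _) _.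
- by move=> y; rewrite /glue; case: ifP.
- rewrite EFinD -gm -integral_glue_reflect//; [|exact/measurable_EFinP].
  by apply: eq_integral => y _; rewrite /glue; case: ifP.
rewrite -integral_glue_reflect//.
- rewrite energy_density_glue le_eqVlt; apply/orP; left; apply/eqP.
  by apply: eq_integral => y _; rewrite /glue /energy_density sqrrN.
- by apply: measurable_energy_density => //; exact: ac_deriv_measurable acg.
- by move=> y; exact: energy_density_ge0.
Qed.

Lemma tau_z_le_approx t s l d w w1 : 0 < w1 -> (tau_z z w1 < +oo)%E -> 0 < w ->
  0 < d -> t < s -> 1 < l -> (G t < +oo)%E ->
  (tau_z z w <= (2 * d + s * w)%:E + (l ^+ 4)%:E * G t)%E.
Proof.
move=> w10 /tau_z_lt[f [D [acf f0 fw1 Eoo]]] w0 d0 ts l1 Goo.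
pose d' := Num.min d (w / 2).
have d'0 : 0 < d' by rewrite lt_min d0 divr_gt0.
have [a [h [g [Dg [acg g0 [h0 gh] mass_a energy_le]]]]] :=
  exists_half_profile z_ge0 z_noninc acf f0 w10 fw1 Eoo d'0 ts l1 Goo.
have d'w : d' <= w / 2 by rewrite ge_min lexx orbT.
have [x ax mass_x] := exists_half_line_mass (ac_deriv_continuous acg) g0 h0 gh mass_a d'w.
have := tau_z_double_le acg g0 mass_x; rewrite -splitr => /le_trans; apply.
have := energy_le x ax; rewrite mass_x.
have G0 := convol_ge0 z t; have Gfin : G t \is a fin_num by rewrite ge0_fin_numE.
rewrite -(fineK Gfin) -!EFinM -!EFinD => half; apply: le_trans (leeD half half) _.
rewrite -EFinD lee_fin; have : d' <= d by rewrite ge_min lexx.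
lra.
Qed.

Lemma tau_z_le_convol t w w1 : 0 < w1 -> (tau_z z w1 < +oo)%E -> 0 <= w ->
  (tau_z z w <= G t + (t * w)%:E)%E.
Proof.
move=> w10 tau1; have G0 := convol_ge0 z t.
rewrite le_eqVlt => /predU1P[<-|w0].
  by rewrite mulr0 adde0; apply: le_trans tau_z0_le0 _.
have [Goo|] := ltP (G t) +oo%E; last by rewrite leye_eq => /eqP ->; rewrite addye// leey.
have Gfin : G t \is a fin_num by rewrite ge0_fin_numE.
set X := fine (G t); have X0 : 0 <= X by rewrite fine_ge0.
apply/lee_addgt0Pr => eps eps0; pose K := 2 + w + 15 * X.
have K0 : 0 < K by rewrite /K; lra.
pose e := Num.min 1 (eps / K); have e0 : 0 < e by rewrite lt_min ltr01 divr_gt0.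
have e1 : e <= 1 by rewrite ge_min lexx.
have eK : K * e <= eps by rewrite mulrC -ler_pdivlMr// ge_min lexx orbT.
have te : t < t + e by rewrite ltrDl.
have l1 : 1 < 1 + e by rewrite ltrDl.
apply: le_trans (tau_z_le_approx w10 tau1 w0 e0 te l1 Goo) _.
have l4 : (1 + e) ^+ 4 <= 1 + 15 * e.
  have e2 : e ^+ 2 <= e by rewrite expr2 ger_pMl.
  have e3 : e ^+ 3 <= e by rewrite exprS; nra.
  have e4 : e ^+ 4 <= e by rewrite exprS; nra.
  have -> : (1 + e) ^+ 4 = 1 + 4 * e + 6 * e ^+ 2 + 4 * e ^+ 3 + e ^+ 4 by ring.
  lra.
rewrite -(fineK Gfin) -/X -!EFinM -!EFinD lee_fin.
have := ler_wpM2r X0 l4; move: eK; rewrite /K; lra.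
Qed.

End Competitors.

Section ConvolutionLsc.
Context {R : realType}.
Local Notation mu := (@lebesgue_measure R).
Variable g : R -> \bar R.
Hypothesis measurable_g : measurable_fun setT g.
Hypothesis g_ge0 : forall x, (0 <= g x)%E.
Local Notation G := (convol g (@r_ker R)).
Implicit Types (t s A : R).

Lemma convol_itv t : G t = (\int[mu]_(s in `]t, +oo[) (g s * (r_ker (t - s))%:E))%E.
Proof.
rewrite [RHS]integral_mkcond; apply: eq_integral => s _; rewrite patchE mem_setE.
by rewrite in_itv/= andbT; case: ltP => // st; rewrite r_ker_sub_eq0// mule0.
Qed.

Lemma convol_r_ker_lsc t A :
  (forall e, 0 < e -> exists2 s, `|s - t| <= e & (G s <= (A + e)%:E)%E) ->
  (G t <= A%:E)%E.
Proof.
move=> near_t; have /choice[s sP] (n : nat) : exists s, `|s - t| <= harmonic n :> R /\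
    (G s <= (A + harmonic n)%:E)%E.
  by have [s] := near_t (harmonic n) (harmonic_gt0 n); exists s.
have harmonic_le e : 0 < e -> \forall n \near \oo, harmonic n <= e :> R.
  move=> e0; have /cvgr_lt/(_ e e0) := @cvg_harmonic R.
  by apply: filterS => n /ltW.
have st : s n @[n --> \oo] --> t.
  apply/cvgrPdist_le => e /harmonic_le; apply: filterS => n.
  by rewrite distrC; apply: le_trans; have [] := sP n.
pose f n x := (g x * (r_ker (s n - x))%:E)%E.
have mf n : measurable_fun setT (f n).
  by apply: emeasurable_funM => //; apply/measurable_EFinP; exact: measurable_r_ker_sub.
have f0 n x : (0 <= f n x)%E by rewrite mule_ge0// lee_fin r_ker_ge0.
rewrite convol_itv.
have -> : (\int[mu]_(x in `]t, +oo[) (g x * (r_ker (t - x))%:E) =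
    \int[mu]_(x in `]t, +oo[) limn_einf (f^~ x))%E.
  apply: eq_integral => x; rewrite inE/= in_itv/= andbT => tx.
  have ker_neq0 : r_ker (t - x) != 0.
    by rewrite r_ker_subE// !mulf_neq0// invr_neq0// mulf_neq0// sqrtr_eq0 -ltNge subr_gt0.
  have ker_cvg : r_ker (s n - x) @[n --> \oo] --> r_ker (t - x).
    apply: continuous_cvg; first by apply: r_ker_continuous; rewrite subr_lt0.
    by apply: cvgB => //; exact: cvg_cst.
  apply/esym/(cvg_limn_einf_sup _).1; apply: cvgeM; first by case: (g x).
    exact: cvg_cst.
  by apply: cvg_EFin; [exact: nearW|exact: ker_cvg].
apply: le_trans (fatou mu _ _ _) _ => //.
  by move=> n; exact: measurable_funS (mf n).
apply/lee_addgt0Pr => e e0; rewrite -EFinD limn_einf_lim.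
apply: lime_le; first exact: is_cvg_einfs.
apply: filterS (harmonic_le e e0) => n ne.
apply: (@le_trans _ _ (\int[mu]_(x in `]t, +oo[) f n x)%E).
  by apply: ereal_inf_lbound; exists n => /=.
apply: (@le_trans _ _ (G (s n))); first by apply: ge0_le_integral_subset => // x _; exact: f0.
by apply: le_trans (sP n).2 _; rewrite lee_fin lerD2l.
Qed.

End ConvolutionLsc.

Section Derivatives.
Context {R : realType}.

Lemma deriv_at_fin_num (T : R -> \bar R) w d : deriv_at T w d -> T w \is a fin_num.
Proof.
by move=> [w0 [[r [r0 fin]] _]]; rewrite -[w]addr0 fin ?normr0// addr0.
Qed.

Lemma deriv_at_near (T : R -> \bar R) w d q : deriv_at T w d -> 0 < q ->
  exists2 e : R, 0 < e & forall k, 0 < k -> k < e -> T (w + k) \is a fin_num /\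
    `|fine (T (w + k)) - fine (T w) - d * k| <= q * k.
Proof.
move=> [w0 [[r [r0 fin]] dif]] q0; have [dl [dl0 dP]] := dif q q0.
exists (Num.min dl r) => [|k k0]; first by rewrite lt_min dl0.
rewrite lt_min => /andP[kd kr]; have wk : 0 <= w + k by lra.
split; first by apply: fin; rewrite ?gtr0_norm.
have := dP k; rewrite gtr0_norm// k0 kd => /(_ isT wk) /ltW.
rewrite -(ler_pM2r k0) -[X in _ * X <= _](gtr0_norm k0) -normrM.
by rewrite mulrBl divfK ?gt_eqF.
Qed.

(* The line [a + s * x] lies above [T] at [w] and [w + 2 * k] and almost touches it at
   [w + k]: it is squeezed between two chords whose slopes are close to [t]. *)
Lemma touching_line_slope (T : R -> R) w t a s k q :
  0 <= w -> 0 < k -> k <= 1 -> 0 <= q ->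
  `|T (w + k) - T w - t * k| <= q * k ->
  `|T (w + 2 * k) - T w - t * (2 * k)| <= q * (2 * k) ->
  T w <= a + s * w -> T (w + 2 * k) <= a + s * (w + 2 * k) ->
  a + s * (w + k) <= T (w + k) + q * k ->
  `|s - t| <= 4 * q /\ a <= T w - t * w + q * (6 + 4 * w).
Proof.
move=> w0 k0 k1 q0; rewrite !ler_norml => /andP[T1a T1b] /andP[T2a T2b] T0s T2s sT1.
have slope_le : s - t <= 2 * q by rewrite -(ler_pM2r k0); lra.
have slope_ge : t - s <= 4 * q by rewrite -(ler_pM2r k0); lra.
split; first by apply/andP; split; lra.
have sw : (t - s) * w <= 4 * q * w by rewrite ler_wpM2r.
have qk : q * k <= q by rewrite ler_piMr.
lra.
Qed.

End Derivatives.

Section TauDerivative.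
Context {R : realType}.
Variable z : R -> \bar R.
Hypothesis z_ge0 : forall x : R, 0 <= x -> (0 <= z x)%E.
Hypothesis z_noninc : nonincreasing0 z.
Local Notation tau := (tau_z z).
Local Notation G := (convol (g_of z) (@r_ker R)).

(* The line [G s + s * _], which lies above [tau], almost touches it at [w]. *)
Lemma exists_multiplier w e : 0 < w -> tau w \is a fin_num -> 0 < e ->
  exists2 s, G s \is a fin_num & fine (G s) + s * w <= fine (tau w) + e.
Proof.
move=> w0 tau_fin e0.
have : (tau w < (fine (tau w) + e)%:E)%E by rewrite -{1}(fineK tau_fin) lte_fin ltrDl.
move=> /(tau_z_lt z_ge0 z_noninc)[f [D [acf f0 fw fE]]].
have [s s0 /le_lt_trans/(_ fE) Gs] :=
  energy_lower_bound z_ge0 z_noninc acf f0 w0 fw (lt_trans fE (ltry _)).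
have Gfin : G s \is a fin_num.
  rewrite ge0_fin_numE ?convol_ge0//; apply: le_lt_trans (lt_trans Gs (ltry _)).
  by rewrite leeDl// lee_fin mulr_ge0// ltW.
by exists s => //; move: Gs; rewrite -(fineK Gfin) -EFinD lte_fin => /ltW.
Qed.

Lemma fine_tau_z_le_convol s w w1 : 0 < w1 -> tau w1 \is a fin_num -> G s \is a fin_num ->
  0 <= w -> tau w \is a fin_num -> fine (tau w) <= fine (G s) + s * w.
Proof.
move=> w10 fin1 Gfin w0 fin; rewrite -lee_fin EFinD !fineK//.
by apply: (tau_z_le_convol z_ge0 z_noninc s w10) => //; rewrite -ge0_fin_numE// tau_z_ge0.
Qed.

Lemma convol_near_deriv w t e : deriv_at tau w t -> 0 < e ->
  exists2 s, `|s - t| <= e & (G s <= (fine (tau w) - t * w + e)%:E)%E.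
Proof.
move=> dtau e0; have w0 := proj1 dtau; pose q := e / (6 + 4 * w).
have c0 : 0 < 6 + 4 * w by lra.
have q0 : 0 < q by rewrite divr_gt0.
have qe : q * (6 + 4 * w) = e by rewrite divfK// gt_eqF.
have [r r0 near_w] := deriv_at_near dtau q0.
pose k := Num.min (r / 3) 1; have k0 : 0 < k by rewrite lt_min divr_gt0/=.
have k1 : k <= 1 by rewrite ge_min lexx orbT.
have kr : k <= r / 3 by rewrite ge_min lexx.
have [||fin1 T1] := near_w k; [by []|by lra|].
have [||fin2 T2] := near_w (2 * k); [by lra|by lra|].
have wk : 0 < w + k by lra.
have [s Gfin sT1] := exists_multiplier wk fin1 (mulr_gt0 q0 k0).
have upper x := fine_tau_z_le_convol wk fin1 Gfin (w := x).
have w2 : 0 <= w + 2 * k by lra.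
have [sle Gle] := @touching_line_slope _ (fine \o tau) w t (fine (G s)) s k q w0 k0 k1
  (ltW q0) T1 T2 (upper w w0 (deriv_at_fin_num dtau)) (upper _ w2 fin2) sT1.
exists s; last by rewrite -(fineK Gfin) lee_fin -qe.
apply: le_trans sle _; rewrite -qe; have := mulr_ge0 (ltW q0) w0; lra.
Qed.

End TauDerivative.

Theorem mainTheorem13 (R : realType) (z : R -> \bar R)
  (z_ge0 : forall x : R, 0 <= x -> (0 <= z x)%E)
  (z_noninc : nonincreasing0 z) (z_lsc : lsc0 z)
  (t : R)
  (ht : exists w : R, 0 <= w /\ deriv_at (tau_z z) w t) :
  conj_tau (tau_z z) t = convol (g_of z) (@r_ker R) t.
Proof.
have [w [w0 dtau]] := ht; have fin := deriv_at_fin_num dtau.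
apply/eqP; rewrite eq_le; apply/andP; split.
  have [e e0 near_w] := deriv_at_near dtau ltr01.
  have [||fin1 _] := near_w (e / 2); [lra|lra|].
  have w1 : 0 < w + e / 2 by lra.
  have tau1 : (tau_z z (w + e / 2) < +oo)%E by rewrite -ge0_fin_numE ?tau_z_ge0.
  apply: ge_ereal_sup => _ [v v0 <-]; rewrite leeBlDr//.
  exact: (tau_z_le_convol z_ge0 z_noninc t w1 tau1 v0).
apply: (@le_trans _ _ (tau_z z w - (t * w)%:E)%E); last first.
  by apply: ereal_sup_ubound; exists w.
rewrite -(fineK fin) -EFinB; apply: convol_r_ker_lsc => [|s|e e0].
- exact: measurable_g_of.
- exact: g_of_ge0.
- exact: convol_near_deriv.
Qed.
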